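(* Let $P\subset\mathbb R^3$ be an empty lattice polytope with $|P|=5$ and $L(P)=1$. Let $Q\subset\mathbb R^3$ be a lattice polytope with $|Q|=4$, $L(Q)=1$, and $L(P+Q)=2$. Then the pair $(P,Q)$ is equivalent to $(E,S_2)$.
   Context: $|P|$ is the number of lattice points of $P$; $P$ is empty if its only lattice points are its vertices. The Minkowski length $L(P)$ is the largest $L$ such that $P$ contains a Minkowski sum of $L$ lattice polytopes each of positive dimension. Pairs $(P,Q)$, $(P',Q')$ are equivalent if there is an affine unimodular map $\varphi$ (i.e. $x\mapsto Ux+b$, $U\in\mathrm{GL}(3,\mathbb Z)$, $b\in\mathbb Z^3$) and lattice vectors $v,w$ with $P'=\varphi(P)+v$, $Q'=\varphi(Q)+w$. $E=\operatorname{conv}\{0,e_1,e_2,e_3,e_1+e_2+e_3\}$, $S_2=\operatorname{conv}\{e_1,e_2,e_3,e_1+e_2+e_3\}$. *)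

(* Defs.v *)
From mathcomp Require Export all_boot all_order all_algebra.
From mathcomp Require Export boolp classical_sets functions cardinality.
From mathcomp Require Export reals convex.

Set Implicit Arguments.
Unset Strict Implicit.
Unset Printing Implicit Defensive.

Import Order.TTheory GRing.Theory Num.Theory.

Local Open Scope classical_set_scope.
Local Open Scope ring_scope.

Section LatticePolytopes.
Variables (R : realType) (n : nat).
Implicit Types (P Q : set 'cV[R]_n) (z b v w : 'cV[int]_n) (L : nat).

Definition conv_hull (A : set 'cV[R]_n) : set 'cV[R]_n :=
  smallest (@convex_set R 'cV[R]_n) A.

Definition of_lattice z : 'cV[R]_n := map_mx intr z.

(* Polytopes are nonempty. *)
Definition lattice_polytope P : Prop :=
  exists A : set 'cV[int]_n,
    [/\ finite_set A, A !=set0 & P = conv_hull (of_lattice @` A)].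

Definition lattice_points P : set 'cV[R]_n := P `&` range of_lattice.

Definition vertex P (x : 'cV[R]_n) : Prop :=
  P x /\ forall (y z : 'cV[R]_n) (t : R), P y -> P z -> 0 < t < 1 ->
    x = t *: y + (1 - t) *: z -> y = x /\ z = x.

Definition empty_polytope P : Prop := lattice_points P `<=` vertex P.

(* The dimension of the affine hull of P: the largest number k of linearly
   independent vectors (the columns of A) that lead from some point p of P to
   points of P; it is 0 for a point (and, by convention, for the empty set). *)
Definition affine_dim P : nat :=
  \max_(k < n.+1 | `[< exists (p : 'cV[R]_n) (A : 'M[R]_(n, k)),
      [/\ P p, forall j, P (p + col j A) & \rank A = k] >]) k.

Definition minkowski_add P Q : set 'cV[R]_n := [set x + y | x in P & y in Q].

(* For L = 0 the sum is [set 0]; for a single lattice point other than 0 no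
   length exists in the sense below, but lengths L >= 1 are unaffected. *)
Definition contains_minkowski_sum P L : Prop :=
  exists F : 'I_L -> set 'cV[R]_n,
    (forall i, lattice_polytope (F i) /\ (0 < affine_dim (F i))%N) /\
    \big[minkowski_add/[set 0]]_(i < L) F i `<=` P.

Definition has_minkowski_length P L : Prop :=
  contains_minkowski_sum P L /\
  forall L', contains_minkowski_sum P L' -> (L' <= L)%N.

Definition affine_unimodular (phi : 'cV[R]_n -> 'cV[R]_n) : Prop :=
  exists (U : 'M[int]_n) b, U \in unitmx /\
    forall x, phi x = map_mx intr U *m x + of_lattice b.

Definition equivalent_pairs P Q P' Q' : Prop :=
  exists (phi : 'cV[R]_n -> 'cV[R]_n) v w,
    [/\ affine_unimodular phi,
        P' = [set phi x + of_lattice v | x in P] &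
        Q' = [set phi x + of_lattice w | x in Q]].

End LatticePolytopes.

Section SpecialPolytopes.
Variable R : realType.

(* Indices in 'I_3 start at 0. *)
Local Notation e1 := (delta_mx (0 : 'I_3) 0 : 'cV[R]_3).
Local Notation e2 := (delta_mx (1 : 'I_3) 0 : 'cV[R]_3).
Local Notation e3 := (delta_mx (2%:R : 'I_3) 0 : 'cV[R]_3).

Definition polytopeE : set 'cV[R]_3 :=
  conv_hull [set 0; e1; e2; e3; e1 + e2 + e3].

Definition polytopeS2 : set 'cV[R]_3 :=
  conv_hull [set e1; e2; e3; e1 + e2 + e3].

End SpecialPolytopes.

Arguments polytopeE : clear implicits.
Arguments polytopeS2 : clear implicits.

(* Main.v *)
(* Let A and B be the sets of lattice points of P and Q. If P + Q contains no sum
   of three segments, then no two lattice points of P + Q are congruent modulo 3.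
   Every triangle with vertices in A, and enough triangles with vertices in B, are
   unimodular. Among all pairs of a unimodular triangle of one set and a difference
   v of two points of the other, choose one with maximal determinant k, and
   coordinates in which the triangle is {0, e1, e2} and v = (x, y, k) with
   0 <= x, y < k. The sum of the triangle and [0, v] contains more than 27 lattice
   points if k > 44, so k <= 44 by the pigeonhole principle modulo 3. Maximality
   of k confines all other points of A and B to explicit boxes, and a computation
   leaves only (E, S2) and configurations in which some point of A lies in the
   convex hull of the others, which emptiness of P forbids. *)
From Stdlib Require Import ZArith Lia List Permutation FMapPositive.
Require Import Defs.
From mathcomp Require Import interval_inference ssrZ.

Import Order.TTheory GRing.Theory Num.Theory.

Set Implicit Arguments.
Unset Strict Implicit.
Unset Printing Implicit Defensive.

Local Notation incl := List.incl.

Local Open Scope Z_scope.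

(** Two lattice points of P + Q that are congruent modulo 3 differ by some 3u, and the segment
    joining them is [0, u] taken three times, up to translation; so P + Q has at most 27 lattice
    points, which makes the problem finite. The maximum k is taken over triangles of both sets at
    once because a new point is boxed by two kinds of bounds: triangles of its own set against
    segments of the other, and triangles of the other set against segments that end in it. The
    maximum may be attained with the triangle in either set, so the search lemmas treat the two sets
    alike and the five-point set must be covered in both roles. The obstacle is that Q need not be
    empty: a triangle of Q can fail to be unimodular, though only if the fourth point is its
    centroid, and these few exceptions join the candidates separately. Points of hulls carry integer
    weights, so that the search and its soundness stay inside the integers; reals enter only in the
    last part. *)

Definition pt : Type := Z * Z * Z.

Definition padd (p q : pt) : pt :=
  let: (a, b, c) := p in let: (x, y, z) := q in (a + x, b + y, c + z).
Definition psub (p q : pt) : pt :=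
  let: (a, b, c) := p in let: (x, y, z) := q in (a - x, b - y, c - z).
Definition pscale (k : Z) (p : pt) : pt :=
  let: (a, b, c) := p in (k * a, k * b, k * c).
(** Nested conditionals replace [&&], both arguments of which would be evaluated under call by
    value. *)
Definition peq (p q : pt) : bool :=
  let: (a, b, c) := p in let: (x, y, z) := q in
  if Z.eqb a x then if Z.eqb b y then Z.eqb c z else false else false.
Definition cross (p q : pt) : pt :=
  let: (a, b, c) := p in let: (x, y, z) := q in
  (b * z - c * y, c * x - a * z, a * y - b * x).
Definition dot (p q : pt) : Z :=
  let: (a, b, c) := p in let: (x, y, z) := q in a * x + b * y + c * z.
Definition det (p q r : pt) : Z := dot (cross p q) r.
Definition primitive (p : pt) : bool :=
  let: (a, b, c) := p in Z.eqb (Z.gcd (Z.gcd a b) c) 1.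

Definition o0 : pt := (0, 0, 0).
Definition e1 : pt := (1, 0, 0).
Definition e2 : pt := (0, 1, 0).

Lemma pt_ext (a b c x y z : Z) : a = x -> b = y -> c = z -> ((a, b, c) : pt) = (x, y, z).
Proof. by move=> -> -> ->. Qed.

Ltac pt_destruct := repeat match goal with p : pt |- _ => destruct p as [[? ?] ?] end.
Ltac pt_unfold := unfold det, dot, cross, psub, padd, pscale, o0, e1, e2.
Ltac pt_ring := pt_destruct; pt_unfold; cbn -[Z.add Z.mul Z.sub Z.opp];
  first [ring | apply: pt_ext; ring].

Lemma pt_inv (a b c x y z : Z) : ((a, b, c) : pt) = (x, y, z) -> [/\ a = x, b = y & c = z].
Proof. by case. Qed.

Lemma peqP (p q : pt) : peq p q = true <-> p = q.
Proof.
case: p => [[a b] c]; case: q => [[x y] z]; rewrite /peq; split.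
  case: Z.eqb_spec => // ->; case: Z.eqb_spec => // ->.
  by move/Z.eqb_eq => ->.
by case=> -> -> ->; rewrite !Z.eqb_refl.
Qed.

Lemma peqN (p q : pt) : peq p q = false -> p <> q.
Proof. by move=> h /peqP; rewrite h. Qed.

(** * Lattice points of convex hulls and of their Minkowski sums *)

(* A lattice point of conv A is encoded by integer weights on points of A. *)
Definition wts (A : list pt) (l : list (Z * pt)) : Prop :=
  Forall (fun wp => 0 <= wp.1 /\ In wp.2 A) l.
Fixpoint wsum (l : list (Z * pt)) : Z :=
  if l is wp :: l' then wp.1 + wsum l' else 0.
Fixpoint lcomb (l : list (Z * pt)) : pt :=
  if l is wp :: l' then padd (pscale wp.1 wp.2) (lcomb l') else o0.

Definition inconv (A : list pt) (z : pt) : Prop :=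
  exists l, [/\ wts A l, 0 < wsum l & pscale (wsum l) z = lcomb l].
(** The equal total weights are one common denominator for both summands, so no rational number
    occurs. *)
Definition insum (A B : list pt) (z : pt) : Prop :=
  exists l m, [/\ wts A l, wts B m, 0 < wsum l, wsum m = wsum l &
                pscale (wsum l) z = padd (lcomb l) (lcomb m)].

Ltac wts_tac :=
  repeat (apply: List.Forall_cons; [split; [cbn; lia|assumption]|]);
  apply: List.Forall_nil.

Definition wscale (c : Z) (l : list (Z * pt)) : list (Z * pt) :=
  List.map (fun wp => (c * wp.1, wp.2)) l.

Lemma wsum_app l m : wsum (app l m) = wsum l + wsum m.
Proof. by elim: l => [|a l IH] //=; rewrite IH; ring. Qed.
Lemma wsum_scale c l : wsum (wscale c l) = c * wsum l.
Proof. by elim: l => [|a l IH] /=; [ring|rewrite IH; ring]. Qed.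
Lemma lcomb_app l m : lcomb (app l m) = padd (lcomb l) (lcomb m).
Proof.
elim: l => [|a l IH] /=; first by case: (lcomb m) => [[? ?] ?].
by rewrite IH; move: (lcomb l) (lcomb m) (pscale _ _) => x y z; pt_ring.
Qed.
Lemma lcomb_scale c l : lcomb (wscale c l) = pscale c (lcomb l).
Proof.
elim: l => [|a l IH] /=; first by rewrite /o0 /pscale; apply: pt_ext; ring.
by rewrite IH; move: (lcomb l) (a.2) (a.1) => x y z; pt_ring.
Qed.
Lemma wts_app A l m : wts A l -> wts A m -> wts A (app l m).
Proof. by move=> hl hm; apply/Forall_app. Qed.
Lemma wts_scale A c l : 0 <= c -> wts A l -> wts A (wscale c l).
Proof.
move=> hc; elim=> [|a l' [h1 h2] _ IH]; constructor => //=.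
by split=> //; apply: Z.mul_nonneg_nonneg.
Qed.

Lemma pscaleA (a b : Z) (p : pt) : pscale (a * b) p = pscale a (pscale b p).
Proof. pt_ring. Qed.
Lemma pscaleDr (a : Z) (p q : pt) : pscale a (padd p q) = padd (pscale a p) (pscale a q).
Proof. pt_ring. Qed.
Lemma pscaleI (a : Z) (p q : pt) : a <> 0 -> pscale a p = pscale a q -> p = q.
Proof.
move=> ha; pt_destruct; pt_unfold => /pt_inv[h1 h2 h3].
by apply: pt_ext; apply: Z.mul_reg_l ha _.
Qed.

Lemma dot_subC (n p q : pt) : dot n (psub q p) = - dot n (psub p q).
Proof. pt_ring. Qed.

Lemma insum_sym A B z : insum A B z -> insum B A z.
Proof.
move=> [l [m [hl hm h0 e E]]]; exists m, l; split=> //; try lia.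
rewrite e E; move: (lcomb l) (lcomb m) => x y; pt_ring.
Qed.

Lemma insum_convex A B y y' z p q : insum A B y -> insum A B y' ->
  0 <= p -> 0 <= q -> 0 < p + q ->
  pscale (p + q) z = padd (pscale p y) (pscale q y') -> insum A B z.
Proof.
move=> [l [m [hl hm h0 e E]]] [l' [m' [hl' hm' h0' e' E']]] hp hq hpq Ez.
have hN : 0 < wsum l * wsum l' by nia.
exists (app (wscale (p * wsum l') l) (wscale (q * wsum l) l')).
exists (app (wscale (p * wsum l') m) (wscale (q * wsum l) m')).
rewrite !wsum_app !wsum_scale !lcomb_app !lcomb_scale e e'; split.
- by apply: wts_app; apply: wts_scale => //; nia.
- by apply: wts_app; apply: wts_scale => //; nia.
- nia.
- ring.
have -> : p * wsum l' * wsum l + q * wsum l * wsum l' = wsum l * wsum l' * (p + q) by ring.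
rewrite pscaleA Ez !pscaleDr.
have -> : pscale (wsum l * wsum l') (pscale p y) =
    pscale (p * wsum l') (pscale (wsum l) y) by rewrite -!pscaleA; congr pscale; ring.
have -> : pscale (wsum l * wsum l') (pscale q y') =
    pscale (q * wsum l) (pscale (wsum l') y') by rewrite -!pscaleA; congr pscale; ring.
rewrite E E'; move: (lcomb l) (lcomb m) (lcomb l') (lcomb m') => a b c d.
pt_ring.
Qed.

Lemma insum_add A B a b : In a A -> In b B -> insum A B (padd a b).
Proof.
move=> ha hb; exists [:: (1, a)], [:: (1, b)]; split=> //=; [wts_tac|wts_tac|pt_ring].
Qed.

(** The eight vertices of z + [0, u] + [0, v] + [0, w] suffice, because conv A + conv B is convex.
    The edges may be parallel or equal. *)
Definition three_sum (A B : list pt) : Prop :=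
  exists z u v w, [/\ u <> o0, v <> o0 & w <> o0] /\
   ([/\ insum A B z, insum A B (padd z u), insum A B (padd z v) & insum A B (padd z w)] /\
    [/\ insum A B (padd z (padd u v)), insum A B (padd z (padd u w)),
        insum A B (padd z (padd v w)) & insum A B (padd z (padd u (padd v w)))]).

Lemma three_sum_sym A B : three_sum A B -> three_sum B A.
Proof.
move=> [z [u [v [w [h [[h1 h2 h3 h4] [h5 h6 h7 h8]]]]]]].
by exists z, u, v, w; split=> //; split; split; apply: insum_sym.
Qed.

Lemma three_sum_of_triple A B z u : u <> o0 -> insum A B z ->
  insum A B (padd z (pscale 3 u)) -> three_sum A B.
Proof.
move=> hu h0 h3.
have h1 : insum A B (padd z u).
  by apply: (insum_convex (p := 2) (q := 1) h0 h3) => //; pt_ring.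
have h2 : insum A B (padd z (padd u u)).
  by apply: (insum_convex (p := 1) (q := 2) h0 h3) => //; pt_ring.
have e3 : pscale 3 u = padd u (padd u u) by pt_ring.
by exists z, u, u, u; rewrite -e3; do !split.
Qed.

Lemma three_sum_of_mod3 A B y z : y <> z -> insum A B y -> insum A B z ->
  (exists u, psub z y = pscale 3 u) -> three_sum A B.
Proof.
move=> hyz hy hz [u hu].
have ez : z = padd y (pscale 3 u) by rewrite -hu; pt_ring.
apply: (@three_sum_of_triple A B y u) => //; last by rewrite -ez.
by move=> hu0; apply: hyz; rewrite ez hu0; pt_ring.
Qed.

(** * Search for a sum of three segments *)

(* Unlike [has] and [all], these stop early under call by value. *)
Fixpoint hasb (T : Type) (f : T -> bool) (l : list T) : bool :=
  if l is x :: l' then if f x then true else hasb f l' else false.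
Fixpoint allb (T : Type) (f : T -> bool) (l : list T) : bool :=
  if l is x :: l' then if f x then allb f l' else false else true.

Lemma hasbP (T : Type) (f : T -> bool) l : hasb f l = true -> exists2 x, In x l & f x = true.
Proof.
elim: l => [|x l IH] //=; case E: (f x) => h; first by exists x; [left|].
by have [y hy fy] := IH h; exists y; [right|].
Qed.
Lemma allbP (T : Type) (f : T -> bool) l : allb f l = true -> forall x, In x l -> f x = true.
Proof.
elim: l => [|x l IH] //=; case E: (f x) => // /IH h y [<-|/h] //.
Qed.
Lemma allbT (T : Type) (f : T -> bool) l : (forall x, In x l -> f x = true) -> allb f l = true.
Proof.
elim: l => [|x l IH] //= h; rewrite h; last by left.
by apply: IH => y hy; apply: h; right.
Qed.

Fixpoint upto (n : nat) (a : Z) : list Z :=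
  if n is S m then a :: upto m (a + 1) else nil.

Lemma in_upto n a t : In t (upto n a) <-> a <= t < a + Z.of_nat n.
Proof.
elim: n a => [|n IH] a; first by split=> //=; lia.
rewrite [upto _ _]/= [In _ _]/= IH; lia.
Qed.

Fixpoint pairs (T : Type) (l : list T) : list (T * T) :=
  if l is x :: l' then app (List.map (pair x) l') (pairs l') else nil.
Fixpoint triples (T : Type) (l : list T) : list (T * (T * T)) :=
  if l is x :: l' then app (List.map (pair x) (pairs l')) (triples l') else nil.

Lemma in_pairs (T : Type) (l : list T) p : In p (pairs l) -> In p.1 l /\ In p.2 l.
Proof.
elim: l => [|x l IH] //= /in_app_iff[/in_map_iff[y [<- hy]]|/IH[h1 h2]] /=; split; auto.
Qed.
Lemma in_triples (T : Type) (l : list T) t :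
  In t (triples l) -> [/\ In t.1 l, In t.2.1 l & In t.2.2 l].
Proof.
elim: l => [|x l IH] //= /in_app_iff[/in_map_iff[y [<- hy]]|/IH[h1 h2 h3]] /=.
  by have [h1 h2] := in_pairs hy; split; auto.
by split; auto.
Qed.

Fixpoint egcd (f : nat) (a b : Z) : Z * Z :=
  if f is S f' then
    if Z.eqb b 0 then (Z.sgn a, 0)
    else let: (x, y) := egcd f' b (a mod b) in (y, x - (a / b) * y)
  else (1, 0).
(** [prism] uses the result only after testing that its product with the normal is 1, so running out
    of the fuel 30 can lose points but cannot invent any. *)
Definition bezout (n : pt) : pt :=
  let: (a, b, c) := n in
  let: (x, y) := egcd 30 a b in
  let: (s, t) := egcd 30 (a * x + b * y) c in (s * x, s * y, t).

(* The lattice points of conv{a, b, c} + [p, q] other than its vertices; the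
   point at height t over the triangle is unique up to translations in its plane. *)
Definition prism (a b c p q : pt) : list pt :=
  let u := psub b a in let w := psub c a in
  let n := cross u w in
  let D0 := dot n (psub q p) in
  if Z.leb (Z.abs D0) 1 then nil else
  let z0 := bezout n in
  if negb (Z.eqb (dot n z0) 1) then nil else
  let: (p', v) := if Z.ltb 0 D0 then (p, psub q p) else (q, psub p q) in
  let D := Z.abs D0 in
  let o := padd a p' in
  let cw := cross w v in let cv := cross v u in
  List.flat_map (fun t =>
    let y := pscale t z0 in
    let z := psub y (padd (pscale (dot cw y / D) u) (pscale (dot cv y / D) w)) in
    let al := dot cw z in let be := dot cv z in
    if Z.leb 0 al then if Z.leb 0 be then if Z.leb (al + be) D then [:: padd o z]
    else nil else nil else nil)
   (upto (Z.to_nat (D - 1)) 1).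

Lemma insum_prism A B a b c p q al be D t z :
  In a A -> In b A -> In c A -> In p B -> In q B ->
  0 <= al -> 0 <= be -> al + be <= D -> 0 < D -> 0 <= t -> t <= D ->
  pscale D z = padd (padd (pscale (D - al - be) a) (padd (pscale al b) (pscale be c)))
                    (padd (pscale (D - t) p) (pscale t q)) -> insum A B z.
Proof.
move=> ha hb hc hp hq h1 h2 h3 hD h4 h5 E.
exists [:: (D - al - be, a); (al, b); (be, c)], [:: (D - t, p); (t, q)].
split; [wts_tac|wts_tac|cbn; lia|cbn; lia|rewrite /=].
have -> : D - al - be + (al + (be + 0)) = D by ring.
rewrite E; pt_ring.
Qed.

Lemma prism_sound A B a b c p q z :
  In a A -> In b A -> In c A -> In p B -> In q B ->
  In z (prism a b c p q) -> insum A B z.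
Proof.
move=> ha hb hc hp hq; rewrite /prism.
set u := psub b a; set w := psub c a; set n := cross u w.
set D0 := dot n _.
case: Z.leb_spec => // hD; set z0 := bezout n.
case: Z.eqb_spec => //= hz0.
set D := Z.abs D0.
(* The endpoints are ordered so that [q'] lies above [p'] with respect to the normal [n]. *)
have [p' [q' [hp' [hq' [-> hDv]]]]] : exists p' q', In p' B /\ (In q' B /\
   ((if Z.ltb 0 D0 then (p, psub q p) else (q, psub p q)) = (p', psub q' p') /\
   dot n (psub q' p') = D)).
  case: Z.ltb_spec => h; [exists p, q|exists q, p]; do !split=> //.
    by rewrite -/D0 /D; lia.
  have eD : D0 = - dot n (psub p q) := dot_subC n p q.
  by move: eD h; rewrite /D; move: (D0) (dot n (psub p q)); clear; lia.
set v := psub q' p' in hDv *; clearbody D; clear hD.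
move=> /in_flat_map[t [/in_upto ht]].
set y := pscale t z0; set z' := psub y _.
case: Z.leb_spec => // hal; case: Z.leb_spec => // hbe; case: Z.leb_spec => // hab.
move=> [<-|//].
set i := dot (cross w v) y / D in z' hal hbe hab *.
set j := dot (cross v u) y / D in z' hal hbe hab *.
have htz : dot n z' = t.
  have -> : t = t * dot n z0 by rewrite hz0; ring.
  rewrite /z' /y; clearbody i j; move: hz0 => _; clearbody z0.
  by rewrite /n; clear; clearbody u w; pt_ring.
clearbody z'; clear i j.
apply: (insum_prism ha hb hc hp' hq' hal hbe hab (t := t)); try lia.
(* Since D = det(u, w, v), Cramer's rule gives D z' = al u + be w + t v. *)
rewrite -htz -hDv /n /v /u /w; clear; pt_ring.
Qed.

(* conv (a :: X) + conv Y is covered by conv X + conv Y, the points a + y, and the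
   prisms having a as a vertex. Only soundness of the search is needed below. *)
Definition newpts (X Y : list pt) (a : pt) : list pt :=
  app (List.map (padd a) Y)
  (app (List.flat_map (fun bc =>
          List.flat_map (fun pq => prism a bc.1 bc.2 pq.1 pq.2) (pairs Y)) (pairs X))
       (List.flat_map (fun t =>
          List.flat_map (fun x => prism t.1 t.2.1 t.2.2 a x) X) (triples Y))).

Lemma newpts_sound A B X Y a z : incl X A -> incl Y B -> In a A ->
  In z (newpts X Y a) -> insum A B z.
Proof.
move=> hX hY ha /in_app_iff[/in_map_iff[y [<- /hY hy]]|/in_app_iff[|]].
- exact: insum_add.
- move=> /in_flat_map[bc [/in_pairs[h1 h2] /in_flat_map[pq [/in_pairs[h3 h4]]]]].
  by apply: prism_sound; auto.
move=> /in_flat_map[t [/in_triples[h1 h2 h3] /in_flat_map[x [hx h]]]].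
by apply: insum_sym; apply: prism_sound h; auto.
Qed.

(* At most one point per residue class modulo 3 can occur; the points found so
   far are stored in a table indexed by their class. *)
Definition key (p : pt) : positive :=
  let: (a, b, c) := p in Z.to_pos (1 + a mod 3 + 3 * (b mod 3) + 9 * (c mod 3)).
Definition table : Type := (PositiveMap.t pt * list pt)%type.
Fixpoint add_pts (l : list pt) (s : table) : option table :=
  if l is p :: l' then
    let k := key p in
    match PositiveMap.find k s.1 with
    | Some q => if peq p q then add_pts l' s else None
    | None => add_pts l' (PositiveMap.add k p s.1, p :: s.2)
    end
  else Some s.
Definition stored (s : table) (p : pt) : bool :=
  if PositiveMap.find (key p) s.1 is Some q then peq p q else false.

Definition table_ok (A B : list pt) (s : table) : Prop :=
  (forall k q, PositiveMap.find k s.1 = Some q -> insum A B q /\ key q = k) /\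
  (forall q, In q s.2 -> insum A B q).

Lemma stored_sound A B s p : table_ok A B s -> stored s p = true -> insum A B p.
Proof.
move=> [h _]; rewrite /stored; case E: PositiveMap.find => [q|] //.
by move/peqP => ->; case: (h _ _ E).
Qed.

Lemma key_inj p q : key p = key q -> exists u, psub p q = pscale 3 u.
Proof.
case: p => [[a b] c]; case: q => [[x y] z]; rewrite /key => h.
have [? [? ?]] : a mod 3 = x mod 3 /\ b mod 3 = y mod 3 /\ c mod 3 = z mod 3.
  have := Z.mod_pos_bound a 3; have := Z.mod_pos_bound b 3; have := Z.mod_pos_bound c 3.
  have := Z.mod_pos_bound x 3; have := Z.mod_pos_bound y 3; have := Z.mod_pos_bound z 3.
  move: h; move: (a mod 3) (b mod 3) (c mod 3) (x mod 3) (y mod 3) (z mod 3) => *.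
  lia.
exists ((a - x) / 3, (b - y) / 3, (c - z) / 3); rewrite /psub /pscale.
by apply: pt_ext; Z.to_euclidean_division_equations; lia.
Qed.

(** Insertion fails only when two distinct points share a class modulo 3, and these would span a sum
    of three segments. *)
Lemma add_pts_sound A B l s : ~ three_sum A B -> table_ok A B s ->
  (forall p, In p l -> insum A B p) ->
  exists2 s', add_pts l s = Some s' & table_ok A B s'.
Proof.
move=> hb; elim: l s => [|p l IH] s hs hl; first by exists s.
rewrite /=; have hp : insum A B p by apply: hl; left.
have hl' q : In q l -> insum A B q by move=> hq; apply: hl; right.
case E: PositiveMap.find => [q|].
  have [hq hk] := hs.1 _ _ E.
  case Ep: (peq p q); first exact: IH.
  case: hb; apply: (@three_sum_of_mod3 A B q p) => //.
    by move=> h; move: (peqN Ep); rewrite h.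
  exact: key_inj.
apply: IH => //; split=> /= [k q|q [<-|/hs.2]] //.
rewrite PositiveMapAdditionalFacts.gsspec.
by case: PositiveMap.E.eq_dec => [-> [<-]|_ /hs.1].
Qed.

(* The eight vertices of a parallelepiped form four pairs with equal sums, so
   pairs of points are sorted by their sums. *)
Definition sum_key (p : pt) : positive :=
  let: (a, b, c) := p in
  Z.to_pos ((a + 128) + 512 * (b + 128) + 262144 * (c + 128)).
Definition buckets (l : list pt) : PositiveMap.t (list (pt * pt)) :=
  List.fold_left (fun m pq => let k := sum_key (padd pq.1 pq.2) in
     PositiveMap.add k (pq :: (if PositiveMap.find k m is Some l then l else nil)) m)
    (pairs l) (PositiveMap.empty _).
(** Here [q1] and [p1] are opposite vertices and [q2], [q3], [q4] the neighbours of [q1]. Opposite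
    vertices all have the sum [s1], which determines [q4] and makes the other three vertices the
    reflections s1 - qi. *)
Definition sum3_from (s : table) (q1 p1 q2 q3 : pt) : bool :=
  if peq q3 q1 then false else
  let q4 := psub (psub (padd p1 (padd q1 q1)) q2) q3 in
  let s1 := padd p1 q1 in
  if peq q4 q1 then false else
  if stored s q4 then if stored s (psub s1 q4) then
  if stored s (psub s1 q2) then stored s (psub s1 q3) else false else false else false.
(** Buckets with three pairs count as well: two equal edges merge two of the four pairs. Three equal
    edges leave only two pairs, but they already collide modulo 3. *)
Definition sum3_in (s : table) (L : list (pt * pt)) : bool :=
  if L is _ :: _ :: _ :: _ then
    let E := app (List.map fst L) (List.map snd L) in
    hasb (fun pq => let: (p1, q1) := pq in
      (fix go (E : list pt) := if E is q2 :: E' then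
        if peq q2 q1 then go E' else
        if hasb (sum3_from s q1 p1 q2) E then true else go E'
        else false) E) L
  else false.
Definition sum3 (s : table) : bool :=
  hasb (fun kl => sum3_in s kl.2) (PositiveMap.elements (buckets s.2)).

Lemma sum3_in_sound A B s L : table_ok A B s ->
  (forall pq, In pq L -> insum A B pq.1 /\ insum A B pq.2) ->
  sum3_in s L = true -> three_sum A B.
Proof.
move=> hs hL; rewrite /sum3_in; case EL: L => [|? [|? [|? L']]] //.
rewrite -EL; set E := app _ _.
have hE q : In q E -> insum A B q.
  by move=> /in_app_iff[] /in_map_iff[pq [<- /hL[]]].
move=> /hasbP[[p1 q1] /hL[/= hp1 hq1]].
have : forall q, In q E -> insum A B q by [].
elim: E {hE} => [|q2 E IH] // hE.
have hE' q : In q E -> insum A B q by move=> hq; apply: hE; right.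
case E2: (peq q2 q1); first by apply: IH.
case H: (hasb _ _); last by move/(IH hE').
move=> _; move/hasbP: H => [q3 /hE hq3].
rewrite /sum3_from; case E3: (peq q3 q1) => //.
set q4 := psub _ q3; case E4: (peq q4 q1) => //.
case h4: (stored _ q4) => //; case h5: stored => //; case h6: stored => // h7.
have hq2 : insum A B q2 by apply: hE; left.
have [{}h4 {}h5 {}h6 {}h7] := And4 (stored_sound hs h4) (stored_sound hs h5)
  (stored_sound hs h6) (stored_sound hs h7).
exists q1, (psub q2 q1), (psub q3 q1), (psub q4 q1).
have nz q : q <> q1 -> psub q q1 <> o0.
  move=> hq h; apply: hq; have -> : q = padd (psub q q1) q1 by clear; pt_ring.
  by rewrite h; pt_ring.
do !split.
- exact: nz (peqN E2).
- exact: nz (peqN E3).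
- exact: nz (peqN E4).
- exact: hq1.
- suff -> : padd q1 (psub q2 q1) = q2 by []. by clear; pt_ring.
- suff -> : padd q1 (psub q3 q1) = q3 by []. by clear; pt_ring.
- suff -> : padd q1 (psub q4 q1) = q4 by []. by clear; pt_ring.
- suff -> : padd q1 (padd (psub q2 q1) (psub q3 q1)) = psub (padd p1 q1) q4 by [].
  by rewrite /q4; clear; pt_ring.
- suff -> : padd q1 (padd (psub q2 q1) (psub q4 q1)) = psub (padd p1 q1) q3 by [].
  by rewrite /q4; clear; pt_ring.
- suff -> : padd q1 (padd (psub q3 q1) (psub q4 q1)) = psub (padd p1 q1) q2 by [].
  by rewrite /q4; clear; pt_ring.
- suff -> : padd q1 (padd (psub q2 q1) (padd (psub q3 q1) (psub q4 q1))) = p1 by [].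
  by rewrite /q4; clear; pt_ring.
Qed.

(** Nothing ties a bucket to the sum of its pairs: a clash of [sum_key] is harmless, since
    [sum3_from] recomputes the remaining vertices and looks them up. *)
Lemma buckets_sound A B l : (forall q, In q l -> insum A B q) ->
  forall k L, PositiveMap.find k (buckets l) = Some L ->
  forall pq, In pq L -> insum A B pq.1 /\ insum A B pq.2.
Proof.
move=> hl; rewrite /buckets.
have : forall pq, In pq (pairs l) -> insum A B pq.1 /\ insum A B pq.2.
  by move=> pq /in_pairs[/hl h1 /hl h2].
have : forall k L, PositiveMap.find k (PositiveMap.empty (list (pt * pt))) = Some L ->
  forall pq, In pq L -> insum A B pq.1 /\ insum A B pq.2.
  by move=> k L; rewrite PositiveMap.gempty.
move: (PositiveMap.empty _); elim: (pairs l) => [|pq P IH] m hm hP //=.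
apply: IH => [k L|pq' h]; last by apply: hP; right.
rewrite PositiveMapAdditionalFacts.gsspec; case: PositiveMap.E.eq_dec => [_ [<-]|_ /hm//].
move=> pq' [<-|]; first by apply: hP; left.
by case E: PositiveMap.find => [L'|] //; exact: hm E _.
Qed.

Lemma sum3_sound A B s : table_ok A B s -> sum3 s = true -> three_sum A B.
Proof.
move=> hs /hasbP[[k L] hin] /=; apply: sum3_in_sound (hs) _.
apply: (@buckets_sound A B s.2 hs.2 k).
by apply: PositiveMap.elements_complete.
Qed.

Definition config : Type := (list pt * list pt * table)%type.
(** The answer [None] certifies a sum of three segments, so the search may drop that branch. *)
Definition addX (c : config) (a : pt) : option config :=
  let: (X, Y, s) := c in
  if add_pts (newpts X Y a) s is Some s' then
    if sum3 s' then None else Some (app X [:: a], Y, s') else None.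
Definition addY (c : config) (a : pt) : option config :=
  let: (X, Y, s) := c in
  if add_pts (newpts Y X a) s is Some s' then
    if sum3 s' then None else Some (X, app Y [:: a], s') else None.

Definition config_ok (A B X Y : list pt) (c : config) : Prop :=
  [/\ c.1.1 = X, c.1.2 = Y, incl X A, incl Y B & table_ok A B c.2].

Lemma addX_sound A B X Y c a : ~ three_sum A B -> config_ok A B X Y c -> In a A ->
  exists2 c', addX c a = Some c' & config_ok A B (app X [:: a]) Y c'.
Proof.
move=> hb; case: c => [[X' Y'] s] [/= -> -> hX hY hs] ha.
have [s' -> hs'] := add_pts_sound hb hs (fun z => newpts_sound hX hY ha (z := z)).
case E: (sum3 s'); first by case: hb; apply: sum3_sound hs' E.
eexists; first by [].
by split=> //= x /in_app_iff[/hX|[<-|]].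
Qed.

Lemma addY_sound A B X Y c a : ~ three_sum A B -> config_ok A B X Y c -> In a B ->
  exists2 c', addY c a = Some c' & config_ok A B X (app Y [:: a]) c'.
Proof.
move=> hb; case: c => [[X' Y'] s] [/= -> -> hX hY hs] ha.
have h z : In z (newpts Y X a) -> insum A B z.
  by move=> hz; apply: insum_sym; apply: newpts_sound hz.
have [s' -> hs'] := add_pts_sound hb hs h.
case E: (sum3 s'); first by case: hb; apply: sum3_sound hs' E.
eexists; first by [].
by split=> //= x /in_app_iff[/hY|[<-|]].
Qed.

(** * The finite search *)

(** A primitive normal means that the two edges at [a] extend to a lattice basis, that is, that the
    triangle is unimodular; collinear points have normal 0 and fail. *)
Definition primitive3 (a b c : pt) : bool := primitive (cross (psub b a) (psub c a)).

(* [hex k x y] holds if there is a lattice point g at height d, 0 < 3 d <= k, such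
   that the segment [0, 3 g] fits into conv{0, e1, e2} + [0, (x, y, k)]. *)
Definition centered_mod (r k : Z) : Z :=
  let m := r mod k in if Z.leb (2 * m) k then m else m - k.
Definition hex (k x y : Z) : bool :=
  hasb (fun d =>
    let r1 := centered_mod (d * x) k in let r2 := centered_mod (d * y) k in
    if Z.leb (3 * Z.abs r1) k then
    if Z.leb (3 * Z.abs r2) k then Z.leb (3 * Z.abs (r1 + r2)) k else false else false)
   (upto (Z.to_nat (k / 3)) 1).

(* What maximality of k implies for a new point a of the set containing X. *)
Definition det_ok (k : Z) (X Y : list pt) (a : pt) : bool :=
  if allb (fun bc => let n := cross (psub bc.1 a) (psub bc.2 a) in
       if allb (fun pq => Z.leb (Z.abs (dot n (psub pq.1 pq.2))) k) (pairs Y)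
       then primitive n else false) (pairs X) then
  allb (fun t => let n := cross (psub t.2.1 t.1) (psub t.2.2 t.1) in
       if allb (fun x => Z.leb (Z.abs (dot n (psub a x))) k) X then true
       else negb (primitive n)) (triples Y)
  else false.

(** At height t the determinant bounds keep a point within distance 1, in each of the first two
    coordinates, of the line through 0 and (x, y, k). Relative to the rounded-down point of the line
    this leaves the offsets -1, 0, 1. *)
Definition box (k x y : Z) (ts : list Z) : list pt :=
  List.flat_map (fun t => let cx := (t * x) / k in let cy := (t * y) / k in
    List.flat_map (fun i => List.map (fun j => (cx + i, cy + j, t)) [:: -1; 0; 1])
      [:: -1; 0; 1]) ts.
Definition candY (k x y : Z) : list pt := box k x y (upto (Z.to_nat (k + 1)) 0).
Definition candX (k x y : Z) (w : pt) : list pt :=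
  let: (n1, n2, _) := cross (x, y, k) w in
  let b := 2 * k * k / Z.max (Z.abs n1) (Z.abs n2) in
  box k x y (upto (Z.to_nat (2 * b + 1)) (- b)).
(* The points that form with two of 0, v, w a triangle whose centroid is the third;
   only such triangles of Q can fail to be unimodular. *)
Definition centroid_cands (v w : pt) : list pt :=
  [:: psub o0 (padd v w); psub (pscale 3 v) w; psub (pscale 3 w) v].

Fixpoint splits (T : Type) (l : list T) : list (T * list T) :=
  if l is x :: l' then (x, l') :: List.map (fun yl => (yl.1, x :: yl.2)) (splits l')
  else nil.
Definition inlist (p : pt) (l : list pt) : bool := hasb (peq p) l.

(** By Cramer's rule [db], [dc], [dd] are the barycentric coordinates of [z] at b, c, d, scaled by
    |D|; the sign [s] makes the scale positive. Points on the boundary count. *)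
Definition in_tetrahedron (A : list pt) : bool :=
  hasb (fun zo => match zo with
   | (z, [:: a; b; c; d]) =>
      let D := det (psub b a) (psub c a) (psub d a) in
      let s := Z.sgn D in
      let db := s * det (psub z a) (psub c a) (psub d a) in
      let dc := s * det (psub b a) (psub z a) (psub d a) in
      let dd := s * det (psub b a) (psub c a) (psub z a) in
      if Z.eqb D 0 then false else if Z.ltb db 0 then false else
      if Z.ltb dc 0 then false else
      if Z.ltb dd 0 then false else Z.leb (db + dc + dd) (s * D)
   | _ => false end) (splits A).
(** The points a0, ..., a4 play 0, e1, e2, e3, e1 + e2 + e3. Up to unimodular equivalence E is
    recognized by a1 + a2 + a3 = a4 + 2 a0 together with the unit determinant. The relation is
    symmetric in a1, a2, a3, so only a0 and a4 have to be guessed. *)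
Definition is_ES2 (A B : list pt) : bool :=
  hasb (fun zo => hasb (fun yo => match zo.1, yo with
   | a0, (a4, [:: a1; a2; a3]) =>
     if peq (padd a1 (padd a2 a3)) (padd a4 (padd a0 a0)) then
       if Z.eqb (Z.abs (det (psub a1 a0) (psub a2 a0) (psub a3 a0))) 1 then
         hasb (fun b => let c := psub b a4 in
           allb (fun a => inlist (padd a c) B) [:: a1; a2; a3; a4]) B
       else false
     else false
   | _, _ => false end) (splits zo.2)) (splits A).
Definition good (A B : list pt) : bool := if in_tetrahedron A then true else is_ES2 A B.

Definition isSome (T : Type) (o : option T) : bool := if o is Some _ then true else false.
(** Either set may be the one with five points, so from 4 + 4 points both extensions 5 + 4 and 4 + 5
    are tested; [good] receives the five-point set first. *)
Definition good_extensions (c : config) (sx sy : list pt) : bool :=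
  allb (fun a => if addX c a is Some c1 then allb (fun w => if addY c1 w is Some c2 then
     if allb (fun a' => if peq a a' then true else
              if addX c2 a' is Some (X, Y, _) then good X Y else true) sx
     then allb (fun w' => if peq w w' then true else
              if addY c2 w' is Some (X, Y, _) then good Y X else true) sy
     else false else true) sy
     else true) sx.
Definition check_triangles (k x y : Z) (w : pt) (c : config) : bool :=
  let v := (x, y, k) in
  let sx := List.filter (fun a => isSome (addX c a))
    (app (centroid_cands e1 e2) (List.filter (det_ok k c.1.1 c.1.2) (candX k x y w))) in
  let sy := List.filter (fun a => isSome (addY c a))
    (app (centroid_cands v w) (List.filter (det_ok k c.1.2 c.1.1) (candY k x y))) in
  good_extensions c sx sy.
Definition check_segment (k x y : Z) (c : config) : bool :=
  allb (fun w => if primitive (cross (x, y, k) w) then if det_ok k c.1.2 c.1.1 w then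
     if addY c w is Some c' then check_triangles k x y w c' else true else true else true)
   (candY k x y).
Definition config0 : config :=
  ([:: o0; e1; e2], [:: o0],
   if add_pts [:: o0; e1; e2] (PositiveMap.empty _, nil) is Some s then s
   else (PositiveMap.empty _, nil)).
Definition check (k x y : Z) : bool :=
  if Z.eqb (Z.gcd (Z.gcd x y) k) 1 then
     if hex k x y then true else
     if addY config0 (x, y, k) is Some c then check_segment k x y c else true
  else true.
Definition check_range (k0 : Z) (n : nat) : bool :=
  allb (fun k => let r := upto (Z.to_nat k) 0 in
    allb (fun x => allb (check k x) r) r) (upto n k0).

(** The upper end 44 is the bound of [det_le_44]. The cast leaves the evaluation to the kernel at
    [Qed], so that it runs only once. *)
Lemma check_range_15_44 : check_range 15 30 = true.
Proof. vm_cast_no_check (erefl true). Qed.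
Lemma check_range_1_14 : check_range 1 14 = true.
Proof. vm_cast_no_check (erefl true). Qed.

(** * Soundness of the search *)

Definition det_bound (k : Z) (A B : list pt) : Prop := forall a b c p q,
  In a A -> In b A -> In c A -> In p B -> In q B -> primitive3 a b c = true ->
  Z.abs (dot (cross (psub b a) (psub c a)) (psub p q)) <= k.
(** For A this holds because all its triangles are unimodular, for B by [sane_centroid_rule]. A
    common rule lets the search run with either set in either role. *)
Definition centroid_rule (A : list pt) : Prop := forall p q r s,
  NoDup [:: p; q; r; s] -> incl [:: p; q; r; s] A -> primitive3 p q r = false ->
  padd p (padd q r) = pscale 3 s.

Lemma primitive3_rot a b c : primitive3 a b c = primitive3 b c a.
Proof. by rewrite /primitive3; congr primitive; pt_ring. Qed.

Lemma det_ok_true k A B X Y a : det_bound k A B -> det_bound k B A ->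
  incl X A -> incl Y B -> In a A ->
  (forall bc, In bc (pairs X) -> primitive3 a bc.1 bc.2 = true) ->
  det_ok k X Y a = true.
Proof.
move=> hA hB hX hY ha hp; rewrite /det_ok.
rewrite allbT => [|bc hbc].
  apply: allbT => t /in_triples[h1 h2 h3].
  case E: (primitive _); last by case: allb.
  rewrite allbT // => x hx; apply/Z.leb_le.
  by apply: hB E; auto.
have [h1 h2] := in_pairs hbc.
rewrite allbT => [|pq /in_pairs[h3 h4]]; first exact: hp.
by apply/Z.leb_le; apply: hA (hp _ hbc); auto.
Qed.

Lemma in_box k x y ts wx wy t : 0 < k -> In t ts ->
  Z.abs (k * wx - t * x) <= k -> Z.abs (k * wy - t * y) <= k ->
  In (wx, wy, t) (box k x y ts).
Proof.
move=> hk ht hx hy; apply/in_flat_map; exists t; split=> //.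
have near z r : Z.abs (k * z - r) <= k -> In (z - r / k) [:: -1; 0; 1].
  move=> h; have : -1 <= z - r / k <= 1 by Z.to_euclidean_division_equations; nia.
  by rewrite /=; lia.
apply/in_flat_map; exists (wx - (t * x) / k); split; first exact: near.
apply/in_map_iff; exists (wy - (t * y) / k); split; last exact: near.
by apply: pt_ext; ring.
Qed.

Lemma primitive_or_centroid A a v w : centroid_rule A ->
  NoDup [:: a; o0; v; w] -> incl [:: a; o0; v; w] A ->
  In a (centroid_cands v w) \/
  [/\ primitive3 a o0 v = true, primitive3 a o0 w = true & primitive3 a v w = true].
Proof.
move=> hA nd iA.
have perm l : Permutation [:: a; o0; v; w] l -> NoDup l /\ incl l A.
  move=> h; split; first exact: Permutation_NoDup nd.
  by move=> z hz; apply: iA; apply: Permutation_in (Permutation_sym h) hz.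
case p1: (primitive3 a o0 v); last first.
  have := hA a o0 v w nd iA p1 => h; left; right; right; left.
  by rewrite -h; pt_ring.
case p2: (primitive3 a o0 w); last first.
  have [|nd' iA'] := perm [:: a; o0; w; v].
    by do 2!apply: perm_skip; apply: perm_swap.
  have := hA a o0 w v nd' iA' p2 => h; left; right; left.
  by rewrite -h; pt_ring.
case p3: (primitive3 a v w); last first.
  have [|nd' iA'] := perm [:: a; v; w; o0].
    apply: perm_skip; apply: Permutation_trans (perm_swap _ _ _) _.
    by apply: perm_skip; apply: perm_swap.
  have h := hA a v w o0 nd' iA' p3; left; left.
  have -> : a = psub (padd a (padd v w)) (padd v w) by pt_ring.
  by rewrite h; pt_ring.
by right.
Qed.

Lemma psub_o0 (p : pt) : psub p o0 = p.
Proof. pt_ring. Qed.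

Lemma abs_mul_le (a b c : Z) : Z.abs a <= c -> Z.abs b <= c -> Z.abs (a * b) <= c * c.
Proof. by move=> ha hb; rewrite Z.abs_mul; apply: Z.mul_le_mono_nonneg => //; lia. Qed.

Section Search.
Variables (A B : list pt) (k x y : Z).
Let v : pt := (x, y, k).
Hypotheses (hk : 0 < k) (no3 : ~ three_sum A B).
Hypotheses (hA : det_bound k A B) (hB : det_bound k B A).
Hypotheses (cA : centroid_rule A) (cB : centroid_rule B).
Hypotheses (A0 : In o0 A) (A1 : In e1 A) (A2 : In e2 A).
Hypotheses (B0 : In o0 B) (Bv : In v B).

(** The triangle 0, e1, e2 against the segments from w to 0 and from w to v puts the height of w
    between 0 and k; the triangle 0, v, w against e1 and e2 keeps w near the line through v. *)
Lemma in_candY w : In w B -> primitive3 w o0 v = true -> In w (candY k x y).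
Proof.
case: w => [[wx wy] wz] hw; rewrite primitive3_rot => hp.
have h1 := hA A0 A1 A2 hw B0 erefl.
have h2 := hA A0 A1 A2 hw Bv erefl.
have h3 := hB B0 Bv hw A1 A0 hp.
have h4 := hB B0 Bv hw A2 A0 hp.
cbv beta iota delta [dot cross psub o0 e1 e2 v] in h1, h2, h3, h4.
by apply: in_box => //; [apply/in_upto|..]; lia.
Qed.

Lemma in_candX a w : In w B -> primitive (cross v w) = true -> In a A ->
  primitive3 a o0 e1 = true -> primitive3 a o0 e2 = true -> In a (candX k x y w).
Proof.
case: w => [[wx wy] wz]; case: a => [[ax ay] az] hw pw ha p1 p2.
have h0 := hA A0 A1 A2 hw B0 erefl.
rewrite primitive3_rot in p1; rewrite primitive3_rot in p2.
have h1 := hA A0 A1 ha Bv B0 p1.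
have h2 := hA A0 A1 ha hw B0 p1.
have h3 := hA A0 A2 ha Bv B0 p2.
have h4 := hA A0 A2 ha hw B0 p2.
cbv beta iota delta [dot cross psub o0 e1 e2 v] in h0, h1, h2, h3, h4; rewrite /candX /v /cross.
set n1 := y * wz - k * wy; set n2 := k * wx - x * wz.
have hn1 : Z.abs az * Z.abs n1 <= 2 * k * k.
  rewrite -Z.abs_mul; have -> : az * n1 =
    k * (ay * wz - az * wy) - wz * (ay * k - az * y) by rewrite /n1; ring.
  have ? : Z.abs (ay * wz - az * wy) <= k by lia.
  have ? : Z.abs (ay * k - az * y) <= k by lia.
  have ? : Z.abs wz <= k by lia.
  have ? : Z.abs (wz * (ay * k - az * y)) <= k * k by exact: abs_mul_le.
  have ? : Z.abs (k * (ay * wz - az * wy)) <= k * k by apply: abs_mul_le => //; lia.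
  lia.
have hn2 : Z.abs az * Z.abs n2 <= 2 * k * k.
  rewrite -Z.abs_mul; have -> : az * n2 =
    wz * (ax * k - az * x) - k * (ax * wz - az * wx) by rewrite /n2; ring.
  have ? : Z.abs (ax * wz - az * wx) <= k by lia.
  have ? : Z.abs (ax * k - az * x) <= k by lia.
  have ? : Z.abs wz <= k by lia.
  have ? : Z.abs (wz * (ax * k - az * x)) <= k * k by exact: abs_mul_le.
  have ? : Z.abs (k * (ax * wz - az * wx)) <= k * k by apply: abs_mul_le => //; lia.
  lia.
have hm : 0 < Z.max (Z.abs n1) (Z.abs n2).
  case: (Z.eq_dec n1 0) => [z1|]; last lia.
  case: (Z.eq_dec n2 0) => [z2|]; last lia.
  (* The cross product is orthogonal to v, whose last coordinate k is not 0, so the third coordinate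
     vanishes with the first two. *)
  have z3 : x * wy - y * wx = 0.
    have : k * (x * wy - y * wx) = - x * n1 - y * n2 by rewrite /n1 /n2; ring.
    rewrite z1 z2 => e; case: (Z.mul_eq_0_r k (x * wy - y * wx)) => //; lia.
  by move: pw; rewrite /v /primitive /cross -/n1 -/n2 z1 z2 z3.
apply: in_box => //; [apply/in_upto|lia|lia].
suff : Z.abs az <= 2 * k * k / Z.max (Z.abs n1) (Z.abs n2) by lia.
apply: Z.div_le_lower_bound => //.
by case: (Z.max_spec (Z.abs n1) (Z.abs n2)) => [[_ ->]|[_ ->]]; lia.
Qed.

Lemma in_candidatesX X Y w a : In w B -> primitive (cross v w) = true -> In a A ->
  ~ In a [:: o0; e1; e2] -> X = [:: o0; e1; e2] -> incl Y B ->
  In a (app (centroid_cands e1 e2) (List.filter (det_ok k X Y) (candX k x y w))).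
Proof.
move=> hw pw ha na -> hY; apply/in_app_iff.
have iA : incl [:: a; o0; e1; e2] A by move=> z [<-//|[<-//|[<-//|[<-|]]]].
have nd : NoDup [:: a; o0; e1; e2].
  by constructor=> //; repeat constructor => //=; intuition.
have [|[p1 p2 p3]] := primitive_or_centroid cA nd iA; first by left.
right; apply/filter_In; split; first exact: in_candX pw _ _ _.
apply: (det_ok_true hA hB) => //; first by move=> z [<-|[<-|[<-|]]].
by move=> bc [<-|[<-|[<-|]]].
Qed.

Lemma in_candidatesY X Y w b : In w B -> NoDup [:: b; o0; v; w] -> In b B ->
  Y = [:: o0; v; w] -> incl X A ->
  In b (app (centroid_cands v w) (List.filter (det_ok k Y X) (candY k x y))).
Proof.
move=> hw nd hb -> hX; apply/in_app_iff.
have iB : incl [:: b; o0; v; w] B by move=> z [<-//|[<-//|[<-//|[<-|]]]].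
have [|[p1 p2 p3]] := primitive_or_centroid cB nd iB; first by left.
right; apply/filter_In; split; first exact: in_candY.
apply: (det_ok_true hB hA) => //; first by move=> z [<-|[<-|[<-|]]].
by move=> bc [<-|[<-|[<-|]]].
Qed.

Lemma config0_ok : config_ok A B [:: o0; e1; e2] [:: o0] config0.
Proof.
have h : table_ok A B (PositiveMap.empty _, nil).
  by split=> [k' q|//]; rewrite PositiveMap.gempty.
have hp p : In p [:: o0; e1; e2] -> insum A B p.
  move=> hp; have -> : p = padd p o0 by clear; pt_ring.
  by apply: insum_add => //; case: hp => [<-|[<-|[<-|]]].
have [s' E hs'] := add_pts_sound no3 h hp.
rewrite /config0 E; split=> //= z; first by case=> [<-|[<-|[<-|]]].
by case=> [<-|].
Qed.

(** The actual points follow one path through the nested loops of [check]. As there is no sum of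
    three segments, every [addX] and [addY] on this path succeeds, and the path ends at the test
    [good]. *)
Lemma search w a b : check k x y = true -> Z.gcd (Z.gcd x y) k = 1 ->
  hex k x y = false -> In w B -> primitive (cross v w) = true ->
  In a A -> ~ In a [:: o0; e1; e2] -> In b B -> NoDup [:: b; o0; v; w] ->
  (forall a', In a' A -> ~ In a' [:: o0; e1; e2] -> a <> a' ->
     good [:: o0; e1; e2; a; a'] [:: o0; v; w; b] = true) /\
  (forall b', In b' B -> NoDup [:: b'; o0; v; w] -> b <> b' ->
     good [:: o0; v; w; b; b'] [:: o0; e1; e2; a] = true).
Proof.
move=> hc hg hh hw pw ha na hb nb.
have : (if addY config0 v is Some c then check_segment k x y c else true) = true.
  by move: hc; rewrite /check hg hh.
have [[[X1 Y1] s1] -> ok1] := addY_sound no3 config0_ok Bv.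
have [/= eX1 eY1 iX1 iY1 _] := ok1; rewrite /check_segment.
have pw' : primitive3 w o0 v = true.
  rewrite primitive3_rot; suff -> : primitive3 o0 v w = primitive (cross v w) by [].
  by rewrite /primitive3 !psub_o0.
move/allbP => /(_ w (in_candY hw pw')); rewrite -/v pw.
have -> : det_ok k Y1 X1 w = true.
  rewrite eX1 eY1; apply: (det_ok_true hB hA) => //.
  by move=> bc [<-|].
have [[[X2 Y2] s2] -> ok2] := addY_sound no3 ok1 hw.
have [/= eX2 eY2 iX2 iY2 _] := ok2; rewrite /check_triangles /good_extensions.
set sx := List.filter _ _; set sy := List.filter _ _.
have hsx a' : In a' A -> ~ In a' [:: o0; e1; e2] -> In a' sx.
  move=> ha' na'; apply/filter_In; split.
    by apply: in_candidatesX pw ha' na' _ _ => //; rewrite eY2.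
  by have [c' ->] := addX_sound no3 ok2 ha'.
have hsy b' : In b' B -> NoDup [:: b'; o0; v; w] -> In b' sy.
  move=> hb' nb'; apply/filter_In; split.
    by apply: in_candidatesY nb' hb' _ _ => //; rewrite eX2.
  by have [c' ->] := addY_sound no3 ok2 hb'.
move/allbP => /(_ a (hsx a ha na)).
have [c3 -> ok3] := addX_sound no3 ok2 ha.
move/allbP => /(_ b (hsy b hb nb)).
have [c4 -> ok4] := addY_sound no3 ok3 hb.
case E1: (allb _ sx) => // E2; split=> [a' ha' na' haa'|b' hb' nb' hbb'].
  move/allbP: E1 => /(_ a' (hsx a' ha' na')).
  case E: (peq a a'); first by move/peqP: E.
  by have [[[X5 Y5] s5] -> [/= -> -> _ _ _]] := addX_sound no3 ok4 ha'.
move/allbP: E2 => /(_ b' (hsy b' hb' nb')).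
case E: (peq b b'); first by move/peqP: E.
by have [[[X5 Y5] s5] -> [/= -> -> _ _ _]] := addY_sound no3 ok4 hb'.
Qed.
End Search.

(** * Unimodular maps *)

Definition linear_map (f : pt -> pt) : Prop :=
  (forall p q, f (padd p q) = padd (f p) (f q)) /\
  (forall c p, f (pscale c p) = pscale c (f p)).
(** Carrying the inverse along keeps matrices out until the final passage to the reals. *)
Definition unimodular (f g : pt -> pt) : Prop :=
  [/\ linear_map f, linear_map g, forall p, g (f p) = p & forall p, f (g p) = p].

Lemma psubE p q : psub p q = padd p (pscale (-1) q).
Proof. pt_ring. Qed.
Lemma padd_o0 p : padd p o0 = p.
Proof. pt_ring. Qed.
Lemma padd_sub p q : padd p (psub q p) = q.
Proof. pt_ring. Qed.
Lemma linear_sub f p q : linear_map f -> f (psub p q) = psub (f p) (f q).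
Proof. by case=> hD hZ; rewrite !psubE hD hZ. Qed.
Lemma linear_o0 f : linear_map f -> f o0 = o0.
Proof.
case=> _ hZ; have -> : o0 = pscale 0 o0 by pt_ring.
by rewrite hZ; case: (f o0) => [[a b] c].
Qed.

Lemma unimodular_sym f g : unimodular f g -> unimodular g f.
Proof. by case. Qed.
Lemma unimodular_inj f g p q : unimodular f g -> f p = f q -> p = q.
Proof. by case=> _ _ h _ e; rewrite -(h p) -(h q) e. Qed.
Lemma unimodular_comp f g f' g' : unimodular f g -> unimodular f' g' ->
  unimodular (fun p => f' (f p)) (fun p => g (g' p)).
Proof.
move=> [[f1 f2] [g1 g2] fg gf] [[f1' f2'] [g1' g2'] fg' gf']; split=> [||p|p].
- by split=> [p q|c p]; rewrite ?f1 ?f1' ?f2 ?f2'.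
- by split=> [p q|c p]; rewrite ?g1' ?g1 ?g2' ?g2.
- by rewrite fg' fg.
- by rewrite gf gf'.
Qed.

Definition e3 : pt := (0, 0, 1).
Definition mat_det (f : pt -> pt) : Z := det (f e1) (f e2) (f e3).
Lemma linear_coord f p : linear_map f ->
  f p = padd (pscale p.1.1 (f e1)) (padd (pscale p.1.2 (f e2)) (pscale p.2 (f e3))).
Proof.
by case=> hD hZ; rewrite -!hZ -!hD; congr f; rewrite /e3; pt_ring.
Qed.
Lemma det_linear f x y z : linear_map f ->
  det (f x) (f y) (f z) = mat_det f * det x y z.
Proof.
move=> hf; rewrite /mat_det (linear_coord x hf) (linear_coord y hf) (linear_coord z hf).
move: (f e1) (f e2) (f e3) => a b c; pt_ring.
Qed.
Lemma det_unimodular f g x y z : unimodular f g ->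
  Z.abs (det (f x) (f y) (f z)) = Z.abs (det x y z).
Proof.
move=> [hf hg fg gf]; rewrite det_linear // Z.abs_mul.
have e : mat_det g * mat_det f = 1.
  have := det_linear (f e1) (f e2) (f e3) hg; rewrite !fg => h.
  by rewrite {2}/mat_det -h.
suff -> : Z.abs (mat_det f) = 1 by lia.
by have [->|->] := Z.mul_eq_1 _ _ (etrans (Z.mul_comm _ _) e).
Qed.

Definition act23 (x y s t : Z) (p : pt) : pt :=
  let: (a, b, c) := p in (a, x * b + y * c, s * b + t * c).
Definition act12 (x y s t : Z) (p : pt) : pt :=
  let: (a, b, c) := p in (x * a + y * b, s * a + t * b, c).
Definition shear (q r : Z) (p : pt) : pt :=
  let: (a, b, c) := p in (a - q * c, b - r * c, c).
Definition shear12 (q : Z) (p : pt) : pt := let: (a, b, c) := p in (a - q * b, b, c).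
Definition flip3 (p : pt) : pt := let: (a, b, c) := p in (a, b, - c).

Lemma act23_unimodular x y s t : x * t - y * s = 1 ->
  unimodular (act23 x y s t) (act23 t (- y) (- s) x).
Proof.
move=> h; split.
- by split=> [p q|d p]; pt_destruct; rewrite /act23; pt_unfold; apply: pt_ext; ring.
- by split=> [p q|d p]; pt_destruct; rewrite /act23; pt_unfold; apply: pt_ext; ring.
- move=> [[a b] c]; apply: pt_ext; first by [].
    by transitivity ((x * t - y * s) * b); [ring|rewrite h; ring].
  by transitivity ((x * t - y * s) * c); [ring|rewrite h; ring].
- move=> [[a b] c]; apply: pt_ext; first by [].
    by transitivity ((x * t - y * s) * b); [ring|rewrite h; ring].
  by transitivity ((x * t - y * s) * c); [ring|rewrite h; ring].
Qed.
Lemma act12_unimodular x y s t : x * t - y * s = 1 ->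
  unimodular (act12 x y s t) (act12 t (- y) (- s) x).
Proof.
move=> h; split.
- by split=> [p q|d p]; pt_destruct; rewrite /act12; pt_unfold; apply: pt_ext; ring.
- by split=> [p q|d p]; pt_destruct; rewrite /act12; pt_unfold; apply: pt_ext; ring.
- move=> [[a b] c]; apply: pt_ext; last by [].
    by transitivity ((x * t - y * s) * a); [ring|rewrite h; ring].
  by transitivity ((x * t - y * s) * b); [ring|rewrite h; ring].
- move=> [[a b] c]; apply: pt_ext; last by [].
    by transitivity ((x * t - y * s) * a); [ring|rewrite h; ring].
  by transitivity ((x * t - y * s) * b); [ring|rewrite h; ring].
Qed.
Lemma shear_unimodular q r : unimodular (shear q r) (shear (- q) (- r)).
Proof.
split.
- by split=> [p p'|d p]; pt_destruct; rewrite /shear; pt_unfold; apply: pt_ext; ring.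
- by split=> [p p'|d p]; pt_destruct; rewrite /shear; pt_unfold; apply: pt_ext; ring.
- by move=> [[a b] c]; apply: pt_ext; ring.
- by move=> [[a b] c]; apply: pt_ext; ring.
Qed.
Lemma shear12_unimodular q : unimodular (shear12 q) (shear12 (- q)).
Proof.
split.
- by split=> [p p'|d p]; pt_destruct; rewrite /shear12; pt_unfold; apply: pt_ext; ring.
- by split=> [p p'|d p]; pt_destruct; rewrite /shear12; pt_unfold; apply: pt_ext; ring.
- by move=> [[a b] c]; apply: pt_ext; ring.
- by move=> [[a b] c]; apply: pt_ext; ring.
Qed.
Lemma flip3_unimodular : unimodular flip3 flip3.
Proof.
split.
- by split=> [p p'|d p]; pt_destruct; rewrite /flip3; pt_unfold; apply: pt_ext; ring.
- by split=> [p p'|d p]; pt_destruct; rewrite /flip3; pt_unfold; apply: pt_ext; ring.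
- by move=> [[a b] c]; apply: pt_ext; ring.
- by move=> [[a b] c]; apply: pt_ext; ring.
Qed.

Lemma gcd_matrix a b : exists x y s t g,
  [/\ x * t - y * s = 1, x * a + y * b = g, s * a + t * b = 0 & 0 <= g].
Proof.
case: (Z.eq_dec (Z.gcd a b) 0) => [h|h].
  have [-> ->] : a = 0 /\ b = 0 by apply/Z.gcd_eq_0.
  by exists 1, 0, 0, 1, 0.
have [a' ha] := Z.gcd_divide_l a b; have [b' hb] := Z.gcd_divide_r a b.
have [x [y hxy]] : exists x y, x * a + y * b = Z.gcd a b.
  have [x [y E]] := Z.gcd_bezout a b _ erefl.
  by exists x, y.
exists x, y, (- b'), a', (Z.gcd a b); split=> //.
- apply: (Z.mul_reg_r _ _ _ h); transitivity (x * (a' * Z.gcd a b) + y * (b' * Z.gcd a b)).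
    ring.
  by rewrite -ha -hb hxy; ring.
- by rewrite {1}ha {2}hb; ring.
- exact: Z.gcd_nonneg.
Qed.

(** This is the Hermite normal form of a pair of vectors. Dependent vectors are allowed, so r or b
    may be 0, and a single vector is treated by taking the other one to be 0. *)
Lemma normal_form (u w : pt) : exists f g r al b, [/\ unimodular f g,
  f u = (r, 0, 0), f w = (al, b, 0), 0 <= r /\ 0 <= b & (0 < b -> 0 <= al < b)].
Proof.
case: u => [[u1 u2] u3].
have [x [y [s [t [g1 [d1 h1 h2 _]]]]]] := gcd_matrix u2 u3.
have [x' [y' [s' [t' [r [d2 h3 h4 hr]]]]]] := gcd_matrix u1 g1.
have U := unimodular_comp (act23_unimodular d1) (act12_unimodular d2).
set f := (fun p => _) in U.
case Ew : (f w) => [[w1 w2] w3].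
have [x2 [y2 [s2 [t2 [b [d3 h5 h6 hb]]]]]] := gcd_matrix w2 w3.
have U2 := unimodular_comp U (unimodular_comp (act23_unimodular d3)
  (shear12_unimodular (w1 / b))).
do 2!eexists; exists r, (w1 - w1 / b * b), b; split; [exact: U2|..].
- rewrite /f /act23 /act12 /shear12 h1 h2 h3 h4; apply: pt_ext; ring.
- by cbv beta; rewrite Ew /act23 /shear12 h5 h6.
- by [].
- by move=> h; have := Z.mod_pos_bound w1 b h; rewrite Z.mod_eq; lia.
Qed.

(** * Points in convex position *)

Definition closed (X : list pt) : Prop := forall z, inconv X z -> In z X.
(** Three points in progression span [z, z + 2u], a sum of two segments, which length 1 excludes. *)
Definition no_progression (X : list pt) : Prop := forall z u, u <> o0 ->
  In z X -> In (padd z u) X -> In (padd z (pscale 2 u)) X -> False.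

Lemma inconv2 X a b i j z : In a X -> In b X -> 0 <= i -> 0 <= j -> 0 < i + j ->
  pscale (i + j) z = padd (pscale i a) (pscale j b) -> inconv X z.
Proof.
move=> ha hb hi hj hij E; exists [:: (i, a); (j, b)]; split; [wts_tac|cbn; lia|].
by rewrite /= Z.add_0_r E; pt_ring.
Qed.
Lemma inconv3 X a b c i j l z : In a X -> In b X -> In c X ->
  0 <= i -> 0 <= j -> 0 <= l -> 0 < i + j + l ->
  pscale (i + j + l) z = padd (pscale i a) (padd (pscale j b) (pscale l c)) ->
  inconv X z.
Proof.
move=> ha hb hc hi hj hl hij E; exists [:: (i, a); (j, b); (l, c)].
split; [wts_tac|cbn; lia|].
by rewrite /= Z.add_0_r Z.add_assoc E; pt_ring.
Qed.

Lemma psub_neq0 p q : p <> q -> psub p q <> o0.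
Proof.
move=> h e; apply: h; have -> : p = padd (psub p q) q by pt_ring.
by rewrite e; pt_ring.
Qed.

(** A lattice point strictly inside the segment gives it lattice length r at least 2; its first
    three lattice points, counted from x, then form a progression in X. *)
Lemma not_between X x y z i j : closed X -> no_progression X ->
  In x X -> In y X -> x <> y -> x <> z -> y <> z -> 0 <= i -> 0 <= j -> 0 < i + j ->
  pscale (i + j) z = padd (pscale i x) (pscale j y) -> False.
Proof.
move=> cX nX hx hy hxy hxz hyz hi hj hij E.
have [f [g [r [al [b [U fy _ [hr _] _]]]]]] := normal_form (psub y x) o0.
have [hf hg fg gf] := U.
have Ez : pscale (i + j) (f (psub z x)) = pscale j (r, 0, 0).
  rewrite -fy -!hf.2; congr f; move: E; clear; pt_destruct; pt_unfold.
  by move=> /pt_inv[h1 h2 h3]; apply: pt_ext; lia.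
have hr0 : r <> 0.
  move=> r0; apply: (psub_neq0 (not_eq_sym hxy)).
  by apply: (unimodular_inj U); rewrite fy r0 linear_o0.
case Et : (f (psub z x)) Ez => [[t1 t2] t3] /pt_inv[E1 E2 E3].
have t20 : t2 = 0 by nia. have t30 : t3 = 0 by nia.
have t10 : t1 <> 0.
  move=> t10; apply: (psub_neq0 (not_eq_sym hxz)).
  by apply: (unimodular_inj U); rewrite Et t10 t20 t30 linear_o0.
have t1r : t1 <> r.
  move=> t1r; apply: hyz; have := unimodular_inj (p := psub y x) (q := psub z x) U.
  rewrite fy Et t1r t20 t30 => /(_ erefl) h.
  have -> : y = padd (psub y x) x by clear; pt_ring.
  by rewrite h; clear; pt_ring.
have hr2 : 2 <= r by nia.
have Ey : y = padd x (pscale r (g (1, 0, 0))).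
  have -> : y = padd x (psub y x) by clear; pt_ring.
  rewrite -hg.2 -(fg (psub y x)) fy; congr (padd x (g _)).
  by apply: pt_ext; ring.
apply: (nX x (g (1, 0, 0))) => //.
- by move=> h; have := gf (1, 0, 0); rewrite h linear_o0.
- apply: cX; apply: (inconv2 (i := r - 1) (j := 1) hx hy); try lia.
  by rewrite Ey; move: (g _) => q; clear; pt_ring.
- apply: cX; apply: (inconv2 (i := r - 2) (j := 2) hx hy); try lia.
  by rewrite Ey; move: (g _) => q; clear; pt_ring.
Qed.

Lemma primitiveP n : primitive n = true <-> exists z, dot n z = 1.
Proof.
case: n => [[a b] c]; rewrite /primitive; split.
  move/Z.eqb_eq => h.
  have [x [y E]] := Z.gcd_bezout a b _ erefl.
  have [s [t E']] := Z.gcd_bezout (Z.gcd a b) c _ h.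
  by exists (s * x, s * y, t); rewrite /dot -E' -E; ring.
move=> [[[x y] z] h]; apply/Z.eqb_eq.
set d := Z.gcd _ c.
have [c' hc] : (d | c) by apply: Z.gcd_divide_r.
have [m hm] : (d | Z.gcd a b) by apply: Z.gcd_divide_l.
have [a' ha] := Z.gcd_divide_l a b; have [b' hb] := Z.gcd_divide_r a b.
have hd : 0 <= d by apply: Z.gcd_nonneg.
have E : d * (m * (a' * x + b' * y) + c' * z) = 1.
  transitivity (a' * (m * d) * x + b' * (m * d) * y + c' * d * z); first by ring.
  by rewrite -hm -ha -hb -hc.
by have [?|?] := Z.mul_eq_1 _ _ E; lia.
Qed.

(** The normal itself does not transform by f. Its primitivity does transfer, because it says that
    some z has det(u, w, z) = 1 or -1. *)
Lemma primitive_cross f g u w : unimodular f g ->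
  primitive (cross (f u) (f w)) = primitive (cross u w).
Proof.
have sgn n z : Z.abs (dot n z) = 1 -> exists z', dot n z' = 1.
  move=> h; have [e|e] : dot n z = 1 \/ dot n z = -1 by lia.
    by exists z.
  exists (pscale (-1) z); suff -> : dot n (pscale (-1) z) = - dot n z by lia.
  by clear; pt_ring.
have imp f' g' u' w' : unimodular f' g' -> primitive (cross (f' u') (f' w')) = true ->
    primitive (cross u' w') = true.
  move=> U /primitiveP[z hz]; apply/primitiveP; apply: (sgn _ (g' z)).
  have [_ _ _ gf] := U.
  by have := det_unimodular u' w' (g' z) U; rewrite gf /det hz => <-.
move=> U; case E: (primitive (cross u w)).
  have [_ _ fg _] := U.
  by apply: imp (unimodular_sym U) _; rewrite !fg.
case E': (primitive _) => //; by rewrite (imp _ _ _ _ U E') in E.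
Qed.

(** In normal form the edges are (r, 0) and (al, m). Absence of progressions forces r = 1 and
    excludes m = 0, and m = 1 would be unimodular; for m at least 2 the triangle has a lattice point
    at height 1. *)
Lemma triangle_lattice_point X a b c : closed X -> no_progression X ->
  NoDup [:: a; b; c] -> incl [:: a; b; c] X -> primitive3 a b c = false ->
  exists s i j l, [/\ In s X, ~ In s [:: a; b; c],
    0 <= i /\ 0 <= j /\ 0 <= l, 0 < i + j + l &
    pscale (i + j + l) s = padd (pscale i a) (padd (pscale j b) (pscale l c))].
Proof.
move=> cX nX nd iX; rewrite /primitive3.
have [ha hb hc] : [/\ In a X, In b X & In c X] by split; apply: iX => /=; auto.
have [hab hac hbc] : [/\ a <> b, a <> c & b <> c].
  by inversion nd as [|? ? n1 nd1]; inversion nd1 as [|? ? n2 _]; split=> e;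
    [apply: n1|apply: n1|apply: n2]; rewrite e /=; auto.
have [f [g [r [al [m [U fb fc [hr hm] hal]]]]]] := normal_form (psub b a) (psub c a).
have [hf hg fg gf] := U.
rewrite -(primitive_cross _ _ U) fb fc => np.
have Eb : psub b a = g (r, 0, 0) by rewrite -fb fg.
have Ec : psub c a = g (al, m, 0) by rewrite -fc fg.
have gE p : g p = padd (pscale p.1.1 (g e1)) (padd (pscale p.1.2 (g e2)) (pscale p.2 (g e3))).
  exact: linear_coord.
have Eb' : b = padd a (pscale r (g e1)).
  have -> : b = padd a (psub b a) by clear; pt_ring.
  by rewrite Eb gE; move: (g e1) (g e2) (g e3); clear => *; pt_ring.
have Ec' : c = padd a (padd (pscale al (g e1)) (pscale m (g e2))).
  have -> : c = padd a (psub c a) by clear; pt_ring.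
  by rewrite Ec gE; move: (g e1) (g e2) (g e3); clear => *; pt_ring.
have inj p q : padd a (g p) = padd a (g q) -> p = q.
  move=> h; apply: (unimodular_inj (unimodular_sym U)).
  have e x : x = psub (padd a x) a by clear; pt_ring.
  by rewrite (e (g p)) (e (g q)) h.
have r0 : r <> 0.
  by move=> r0; apply: hab; rewrite Eb' r0; move: (g e1); clear => *; pt_ring.
have r1 : r = 1.
  case: (Z.eq_dec r 1) => // r1.
  exfalso; apply: (not_between (x := a) (y := b) (z := padd a (g e1)) (i := r - 1) (j := 1)
    cX nX ha hb hab); try lia.
  - by move=> h; have := inj o0 e1; rewrite linear_o0 // -h padd_o0 => /(_ erefl).
  - by move=> h; have := inj (r, 0, 0) e1; rewrite -Eb -h padd_sub => /(_ erefl) [].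
  - by rewrite Eb'; move: (g e1); clear => *; pt_ring.
have m0 : m <> 0.
  move=> m0; rewrite m0 in Ec'.
  have E : c = padd a (pscale al (g e1)) by rewrite Ec'; move: (g e1) (g e2); clear => *; pt_ring.
  rewrite r1 in Eb'; have [al0|al1] : al < 0 \/ 0 <= al by lia.
    apply: (not_between (x := c) (y := b) (z := a) (i := 1) (j := - al) cX nX); auto; try lia.
    by rewrite E Eb'; move: (g e1); clear => *; pt_ring.
  have al0' : al <> 0 by move=> z; apply: hac; rewrite E z; move: (g e1); clear => *; pt_ring.
  have al1' : al <> 1 by move=> z; apply: hbc; rewrite E Eb' z.
  apply: (not_between (x := a) (y := c) (z := b) (i := al - 1) (j := 1) cX nX); auto; try lia.
  by rewrite E Eb'; move: (g e1); clear => *; pt_ring.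
have m2 : 2 <= m.
  suff : m <> 1 by lia.
  by move=> m1; move: np; rewrite r1 m1 /cross /primitive /=; case: al {fc Ec Ec' hal}.
have {}hal := hal (ltac:(lia)).
(* At height 1 the triangle starts at al / m, where 0 <= al < m; d is this number rounded up. *)
pose d := if Z.eqb al 0 then 0 else 1.
have hd : d = 0 /\ al = 0 \/ d = 1 /\ 1 <= al by rewrite /d; case: Z.eqb_spec; lia.
have gd p q : g (p, q, 0) = padd (pscale p (g e1)) (pscale q (g e2)).
  by rewrite gE; move: (g e1) (g e2) (g e3); clear => *; pt_ring.
exists (padd a (g (d, 1, 0))), (m - 1 - (d * m - al)), (d * m - al), 1.
have E : pscale (m - 1 - (d * m - al) + (d * m - al) + 1) (padd a (g (d, 1, 0))) =
  padd (pscale (m - 1 - (d * m - al)) a) (padd (pscale (d * m - al) b) (pscale 1 c)).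
  rewrite Ec' Eb' r1 gd; move: (g e1) (g e2); clear => *; pt_ring.
split=> //; try nia.
- by apply: cX; apply: inconv3 E => //; nia.
- move=> [h|[h|[h|//]]].
  + by have := inj o0 (d, 1, 0); rewrite linear_o0 // -h padd_o0 => /(_ erefl).
  + by have := inj (r, 0, 0) (d, 1, 0); rewrite -Eb -h padd_sub => /(_ erefl) [].
  + have := inj (al, m, 0) (d, 1, 0); rewrite -Ec -h padd_sub => /(_ erefl).
    by move=> /pt_inv[_ e _]; lia.
Qed.

(** * Bounding the determinant *)

Lemma insum_std_prism A B x y k al be t z : In o0 A -> In e1 A -> In e2 A ->
  In o0 B -> In (x, y, k) B -> 0 < k -> 0 <= al -> 0 <= be -> al + be <= k ->
  0 <= t -> t <= k ->
  pscale k z = padd (al, be, 0) (pscale t (x, y, k)) -> insum A B z.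
Proof.
move=> A0 A1 A2 B0 Bv hk h1 h2 h3 h4 h5 E.
apply: (insum_prism (al := al) (be := be) (D := k) (t := t) A0 A1 A2 B0 Bv) => //.
by rewrite E; clear; pt_ring.
Qed.

Lemma centered_modP r k : 0 < k -> exists q, r = k * q + centered_mod r k.
Proof.
move=> hk; rewrite /centered_mod; case: Z.leb_spec => _.
  by exists (r / k); rewrite -Z.div_mod //; lia.
by exists (r / k + 1); have := Z.div_mod r k; lia.
Qed.

Ltac vertex_side := first [by rewrite /=; auto | cbn [fst snd o0 e1 e2]; lia].

(** With g = (q1, q2, d), the vector 3g differs from (3d / k) v by -(3 / k) (r1, r2, 0). The tests
    say that this horizontal drift lies in the difference body of the triangle, a hexagon, so a
    translate of [0, 3g] fits into the prism. *)
Lemma hex_sound A B x y k : In o0 A -> In e1 A -> In e2 A -> In o0 B ->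
  In (x, y, k) B -> 0 < k -> hex k x y = true -> three_sum A B.
Proof.
move=> A0 A1 A2 B0 Bv hk /hasbP[d /in_upto hd]; cbv beta zeta.
have [q1 E1] := centered_modP (d * x) hk; have [q2 E2] := centered_modP (d * y) hk.
move: (centered_mod (d * x) k) (centered_mod (d * y) k) E1 E2 => r1 r2 E1 E2.
case: Z.leb_spec => // h1; case: Z.leb_spec => // h2; case: Z.leb_spec => // h3 _.
have hd3 : 3 * d <= k by move: hd; Z.to_euclidean_division_equations; lia.
have hd0 : 0 < d by lia.
have nz : ((q1, q2, d) : pt) <> o0 by move=> /pt_inv[_ _ e]; lia.
have P := insum_std_prism A0 A1 A2 B0 Bv hk.
have vert a : In a [:: o0; e1; e2] -> insum A B a.
  move=> ha; have -> : a = padd a o0 by rewrite padd_o0.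
  by apply: insum_add => //; case: ha => [<-|[<-|[<-|]]].
have vertv a : In a [:: o0; e1; e2] -> insum A B (padd a (x, y, k)).
  by move=> ha; apply: insum_add => //; case: ha => [<-|[<-|[<-|]]].
have up a al be : In a [:: o0; e1; e2] -> 0 <= al -> 0 <= be -> al + be <= k ->
    k * a.1.1 - 3 * r1 = al -> k * a.1.2 - 3 * r2 = be -> a.2 = 0 -> three_sum A B.
  move=> ha hal hbe hab e e' e''.
  apply: (three_sum_of_triple (u := (q1, q2, d)) nz (vert a ha)).
  apply: (P al be (3 * d)) => //; try lia.
  case: a {ha} e e' e'' => [[a1 a2] a3]; cbn [fst snd] => e e' ->; rewrite /pscale /padd.
  by apply: pt_ext; lia.
have down a al be : In a [:: o0; e1; e2] -> 0 <= al -> 0 <= be -> al + be <= k ->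
    k * a.1.1 + 3 * r1 = al -> k * a.1.2 + 3 * r2 = be -> a.2 = 0 -> three_sum A B.
  move=> ha hal hbe hab e e' e''.
  apply: (three_sum_of_triple (u := (q1, q2, d))
    (z := psub (padd a (x, y, k)) (pscale 3 (q1, q2, d))) nz).
    apply: (P al be (k - 3 * d)) => //; try lia.
    case: a {ha} e e' e'' => [[a1 a2] a3]; cbn [fst snd] => e e' ->; rewrite /psub /pscale /padd.
    by apply: pt_ext; lia.
  have -> : padd (psub (padd a (x, y, k)) (pscale 3 (q1, q2, d))) (pscale 3 (q1, q2, d)) =
    padd a (x, y, k) by clear; pt_ring.
  exact: vertv.
(* One case for each of the six sectors of the hexagon: the segment starts at a vertex of the bottom
   triangle ([up]) or ends at one of the top triangle ([down]). *)
case: (Z.le_gt_cases r1 0) => s1; case: (Z.le_gt_cases r2 0) => s2;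
  case: (Z.le_gt_cases (r1 + r2) 0) => s3; try lia.
- by apply: (up o0 _ _ _ _ _ _ erefl erefl erefl); vertex_side.
- by apply: (down e1 _ _ _ _ _ _ erefl erefl erefl); vertex_side.
- by apply: (up e2 _ _ _ _ _ _ erefl erefl erefl); vertex_side.
- by apply: (down e2 _ _ _ _ _ _ erefl erefl erefl); vertex_side.
- by apply: (up e1 _ _ _ _ _ _ erefl erefl erefl); vertex_side.
- by apply: (down o0 _ _ _ _ _ _ erefl erefl erefl); vertex_side.
Qed.

Lemma key_range p : In (key p) (List.map Z.to_pos (upto 27 1)).
Proof.
case: p => [[a b] c]; rewrite /key; apply/in_map_iff.
exists (1 + a mod 3 + 3 * (b mod 3) + 9 * (c mod 3)); split=> //; apply/in_upto.
have := Z.mod_pos_bound a 3; have := Z.mod_pos_bound b 3; have := Z.mod_pos_bound c 3.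
lia.
Qed.

Lemma NoDup_map_in (T U : Type) (f : T -> U) l : NoDup l ->
  (forall x y, In x l -> In y l -> f x = f y -> x = y) -> NoDup (List.map f l).
Proof.
elim: l => [|a l IH] /=; first by constructor.
move=> /NoDup_cons_iff[n1 n2] inj; constructor.
  move=> /in_map_iff[b [e hb]]; apply: n1.
  by rewrite -(inj b a) //; [right|left].
by apply: IH => // x y hx hy; apply: inj; right.
Qed.

Lemma NoDup_upto n a : NoDup (upto n a).
Proof.
elim: n a => [|n IH] a; first by constructor.
by rewrite /=; constructor=> //; rewrite in_upto; lia.
Qed.

(* The half of the heights t and k - t for which the prism contains a lattice point. *)
Definition mid_point (k x y t : Z) : pt :=
  let a := (- (t * x)) mod k in let b := (- (t * y)) mod k in
  let p := (t * x + a) / k in let q := (t * y + b) / k in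
  if Z.leb (a + b) k then (p, q, t) else (x + 1 - p, y + 1 - q, k - t).

(** The six vertices and one lattice point for each t from 1 to 22 make 28 points for 27 classes.
    The heights t and k - t' never coincide for such t and t' once k is at least 45 = 2 * 22 + 1. *)
Lemma det_le_44 A B x y k : ~ three_sum A B -> In o0 A -> In e1 A -> In e2 A ->
  In o0 B -> In (x, y, k) B -> k <= 44.
Proof.
move=> no3 A0 A1 A2 B0 Bv; case: (Z.le_gt_cases k 44) => // hk; exfalso.
have hk0 : 0 < k by lia.
have P := insum_std_prism A0 A1 A2 B0 Bv hk0.
pose V : list pt := [:: o0; e1; e2; (x, y, k); (x + 1, y, k); (x, y + 1, k)].
pose L := app V (List.map (mid_point k x y) (upto 22 1)).
have hmid t : In t (upto 22 1) -> insum A B (mid_point k x y t) /\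
    ((mid_point k x y t).2 = t \/ (mid_point k x y t).2 = k - t).
  move=> /in_upto ht; rewrite /mid_point.
  set a := _ mod k; set b := (- (t * y)) mod k; set p := _ / k; set q := _ / k.
  have ha : 0 <= a < k by apply: Z.mod_pos_bound.
  have hb : 0 <= b < k by apply: Z.mod_pos_bound.
  have ep : k * p = t * x + a.
    rewrite /p -Z_div_exact_full_2 //; first lia.
    by rewrite /a Zplus_mod_idemp_r Z.add_opp_diag_r Zmod_0_l.
  have eq : k * q = t * y + b.
    rewrite /q -Z_div_exact_full_2 //; first lia.
    by rewrite /b Zplus_mod_idemp_r Z.add_opp_diag_r Zmod_0_l.
  (* If (a, b) / k lies outside the triangle, then (k - a, k - b) / k lies inside, and this is the
     position of a lattice point at height k - t. *)
  case: Z.leb_spec => hab; split; auto.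
    by apply: (P a b t) => //; try lia; rewrite /pscale /padd; apply: pt_ext; lia.
  apply: (P (k - a) (k - b) (k - t)) => //; try lia.
  by rewrite /pscale /padd; apply: pt_ext; lia.
have hV p : In p V -> insum A B p.
  move=> [<-|[<-|[<-|[<-|[<-|[<-|//]]]]]].
  - by apply: (P 0 0 0); try lia; rewrite /o0 /pscale /padd; apply: pt_ext; lia.
  - by apply: (P k 0 0); try lia; rewrite /o0 /pscale /padd; apply: pt_ext; lia.
  - by apply: (P 0 k 0); try lia; rewrite /o0 /pscale /padd; apply: pt_ext; lia.
  - by apply: (P 0 0 k); try lia; rewrite /o0 /pscale /padd; apply: pt_ext; lia.
  - by apply: (P k 0 k); try lia; rewrite /o0 /pscale /padd; apply: pt_ext; lia.
  - by apply: (P 0 k k); try lia; rewrite /o0 /pscale /padd; apply: pt_ext; lia.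
have hL p : In p L -> insum A B p.
  by move=> /in_app_iff[/hV//|/in_map_iff[t [<- /hmid[]]]].
have ndL : NoDup L.
  apply: NoDup_app.
  - rewrite /V !NoDup_cons_iff; do !split; try exact: NoDup_nil;
      rewrite /=; intuition; match goal with H : _ = _ :> pt |- _ =>
        move/pt_inv: H => [? ? ?]; lia end.
  - apply: NoDup_map_in; first exact: NoDup_upto.
    move=> t t' ht ht' e; have [_ h] := hmid _ ht; have [_ h'] := hmid _ ht'.
    by move/in_upto: ht; move/in_upto: ht' => /= ? ?; rewrite e in h; lia.
  - move=> p hp /in_map_iff[t [e ht]]; have [_] := hmid _ ht; rewrite e.
    move/in_upto: ht => /= ht.
    by case: hp => [<-|[<-|[<-|[<-|[<-|[<-|//]]]]]] /=; lia.
have ndk : NoDup (List.map key L).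
  apply: NoDup_map_in => // p q hp hq e.
  case E: (peq p q); first exact/peqP.
  case: no3; apply: (@three_sum_of_mod3 A B q p) => //; try exact: hL.
    by move=> h; move: (peqN E); rewrite h.
  exact: key_inj.
have H : incl (List.map key L) (List.map Z.to_pos (upto 27 1)).
  by move=> z /in_map_iff[p [<- _]]; exact: key_range.
have := NoDup_incl_length ndk H.
by rewrite /L !List.length_map List.length_app !List.length_map /=; lia.
Qed.

(** * Configurations *)

(** Every lattice point of conv A is a vertex of it. In particular A contains all lattice points of
    its hull. *)
Definition in_convex_position (A : list pt) : Prop := forall l z, wts A l ->
  0 < wsum l -> pscale (wsum l) z = lcomb l ->
  Forall (fun wp => 0 < wp.1 -> wp.2 = z) l.
(** This is what remains for the lattice points of Q, which need not be in convex position. *)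
Definition sane (X : list pt) : Prop := [/\ NoDup X, closed X & no_progression X].
Definition all_primitive (X : list pt) : Prop := forall a b c,
  NoDup [:: a; b; c] -> incl [:: a; b; c] X -> primitive3 a b c = true.

Lemma positive_weight A l : wts A l -> 0 < wsum l -> exists2 wp, In wp l & 0 < wp.1.
Proof.
elim=> [|wp l' [h _] _ IH] //= hs.
case: (Z.le_gt_cases wp.1 0) => h'; last by exists wp; [left|].
have [|wp' h1 h2] := IH; first by move: hs; rewrite /=; lia.
by exists wp'; [right|].
Qed.

Lemma in_convex_position_closed A : in_convex_position A -> closed A.
Proof.
move=> hA z [l [hl hs E]]; have [wp h1 h2] := positive_weight hl hs.
have := hA l z hl hs E; rewrite List.Forall_forall => /(_ wp h1 h2) <-.
by have := hl; rewrite /wts List.Forall_forall => /(_ wp h1) [].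
Qed.

Lemma in_convex_position_no_progression A : in_convex_position A -> no_progression A.
Proof.
move=> hA z u hu h0 h1 h2.
have : Forall (fun wp => 0 < wp.1 -> wp.2 = padd z u) [:: (1, z); (1, padd z (pscale 2 u))].
  apply: hA; [by wts_tac|by []|].
  by clear; cbn [wsum lcomb fst snd]; pt_ring.
move=> h; apply: hu; move: (List.Forall_inv h) => /(_ erefl) /= e.
have -> : u = psub (padd z u) z by clear; pt_ring.
by rewrite -e; clear; pt_ring.
Qed.

Lemma in_convex_position_primitive A : in_convex_position A -> all_primitive A.
Proof.
move=> hA a b c nd iA; case E: primitive3 => //.
have [s [i [j [l [hs ns [hi [hj hl]] h0 Es]]]]] := triangle_lattice_point
  (in_convex_position_closed hA) (in_convex_position_no_progression hA) nd iA E.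
have [ha hb hc] : [/\ In a A, In b A & In c A] by split; apply: iA => /=; auto.
have h : Forall (fun wp => 0 < wp.1 -> wp.2 = s) [:: (i, a); (j, b); (l, c)].
  apply: hA; [by wts_tac|by cbn; lia|].
  by rewrite /= Z.add_0_r Z.add_assoc Es; pt_ring.
exfalso; apply: ns; move: h; rewrite List.Forall_forall => h.
have [i0|[j0|l0]] : 0 < i \/ 0 < j \/ 0 < l by lia.
- by left; apply: (h (i, a)) => //=; auto.
- by right; left; apply: (h (j, b)) => //=; auto.
- by right; right; left; apply: (h (l, c)) => //=; auto.
Qed.

Lemma NoDup3 (a b c : pt) : NoDup [:: a; b; c] <-> [/\ a <> b, a <> c & b <> c].
Proof.
rewrite !NoDup_cons_iff /=; split.
  by move=> [h1 [h2 _]]; split=> e; [apply: h1|apply: h1|apply: h2]; rewrite e; auto.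
case=> h1 h2 h3; split; [|split; [|split; [|constructor]]]; last by [].
  by case=> [e|[e|]] //; [apply: h1|apply: h2].
by case=> [e|] //; apply: h3.
Qed.
Lemma NoDup4 (a b c d : pt) : NoDup [:: a; b; c; d] <->
  [/\ a <> b, a <> c & a <> d] /\ [/\ b <> c, b <> d & c <> d].
Proof.
rewrite NoDup_cons_iff NoDup3 /=; split=> -[h h']; split=> //.
  by split=> e; apply: h; rewrite e; auto.
by case: h => h1 h2 h3 [e|[e|[e|]]] //; [apply: h1|apply: h2|apply: h3].
Qed.

Lemma in_fourth (B : list pt) p q r s t : NoDup B -> length B = 4%nat ->
  NoDup [:: p; q; r; s] -> incl [:: p; q; r; s] B -> In t B -> In t [:: p; q; r; s].
Proof.
by move=> nB hB nd iB; exact: (NoDup_length_incl nd (Nat.eq_le_incl _ _ hB) iB).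
Qed.

(** Otherwise the triangle p, q, s contains a further lattice point, which can only be r. Then s
    lies in conv{p, q, r} and r in conv{p, q, s}; eliminating s puts r between p and q. *)
Lemma inner_triangle_primitive B p q r s i j l : sane B -> length B = 4%nat ->
  NoDup [:: p; q; r; s] -> incl [:: p; q; r; s] B ->
  0 <= i -> 0 <= j -> 0 <= l -> 0 < i + j + l ->
  pscale (i + j + l) s = padd (pscale i p) (padd (pscale j q) (pscale l r)) ->
  primitive3 p q s = true.
Proof.
move=> [nB cB gB] hB nd iB hi hj hl h0 E.
have [hp hq hr hs] : [/\ In p B, In q B, In r B & In s B] by split; apply: iB => /=; auto.
have [[npq npr nps] [nqr nqs nrs]] : [/\ p <> q, p <> r & p <> s] /\ [/\ q <> r, q <> s & r <> s].
  exact/NoDup4.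
have nd' : NoDup [:: p; q; s] by exact/NoDup3.
case F: (primitive3 p q s); first by [].
exfalso.
have [|t [i' [j' [l' [ht nt [hi' [hj' hl']] h0' E']]]]] :=
  triangle_lattice_point cB gB nd' _ F.
  by move=> z [<-|[<-|[<-|]]].
have et : t = r.
  have := in_fourth nB hB nd iB ht => -[e|[e|[e|[e|//]]]] //; case: nt; rewrite -e /=; auto.
rewrite et in E'; clear et nt ht.
set N := i + j + l in h0 E; set N' := i' + j' + l' in h0' E'.
have hm : 0 <= i' * N + l' * i by nia.
have hn : 0 <= j' * N + l' * j by nia.
case: (Z.eq_dec (i' * N + l' * i + (j' * N + l' * j)) 0) => [z|nz].
  have i'0 : i' = 0 by nia. have j'0 : j' = 0 by nia.
  apply: nrs; apply: (pscaleI (a := N')); first lia.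
  rewrite E' /N' i'0 j'0; clear; pt_ring.
apply: (not_between (x := p) (y := q) (z := r) (i := i' * N + l' * i) (j := j' * N + l' * j)
  cB gB) => //; try lia; try by apply: not_eq_sym.
have -> : i' * N + l' * i + (j' * N + l' * j) = N * N' - l * l' by rewrite /N /N'; ring.
have -> : pscale (N * N' - l * l') r = psub (pscale N (pscale N' r)) (pscale (l * l') r).
  by clear; pt_ring.
rewrite E'.
have -> : pscale N (padd (pscale i' p) (padd (pscale j' q) (pscale l' s))) =
  padd (pscale N (pscale i' p)) (padd (pscale N (pscale j' q)) (pscale l' (pscale N s))).
  by clear; pt_ring.
by rewrite E; clear; pt_ring.
Qed.

Lemma primitive_multiple m n i l : primitive m = true -> primitive n = true ->
  0 <= i -> 0 <= l -> pscale i m = pscale l n -> i = l.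
Proof.
move=> /primitiveP[z hz] /primitiveP[w hw] hi hl E.
have dZ c p q : dot (pscale c p) q = c * dot p q by clear; pt_ring.
have h1 : i = l * dot n z by rewrite -dZ -E dZ hz; ring.
have h2 : l = i * dot m w by rewrite -dZ E dZ hw; ring.
move: (dot n z) (dot m w) h1 h2 => c d h1 h2.
case: (Z.eq_dec i 0) => [i0|i0]; first by move: h2; rewrite i0; lia.
have cd : c * d = 1.
  apply: (Z.mul_reg_l _ _ i i0); rewrite Z.mul_1_r {2}h1 h2; ring.
by case: (Z.mul_eq_1 _ _ cd) => e; rewrite e in h1; lia.
Qed.

(** The fourth point s lies in the triangle and cuts it into three unimodular ones. Crossing i a + j
    b + l c = 0 with a and b makes their primitive normals proportional with the weights as factors,
    so i = j = l. *)
Lemma sane_centroid_rule B : sane B -> length B = 4%nat -> centroid_rule B.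
Proof.
move=> sB hB p q r s nd iB np; have [nB cB gB] := sB.
have [[npq npr nps] [nqr nqs nrs]] := proj1 (NoDup4 _ _ _ _) nd.
have nd3 : NoDup [:: p; q; r] by exact/NoDup3.
have [|t [i [j [l [ht nt [hi [hj hl]] h0 E]]]]] := triangle_lattice_point cB gB nd3 _ np.
  by move=> z hz; apply: iB; move: hz; rewrite /=; intuition.
have et : t = s.
  have := in_fourth nB hB nd iB ht => -[e|[e|[e|[e|//]]]] //; case: nt; rewrite -e /=; auto.
rewrite et in E; clear et nt ht.
have p1 := inner_triangle_primitive sB hB nd iB hi hj hl h0 E.
have p2 : primitive3 q r s = true.
  apply: (@inner_triangle_primitive B q r p s j l i sB hB) => //; try lia.
  - by apply/NoDup4; split; split=> //; apply: not_eq_sym.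
  - by move=> z hz; apply: iB; move: hz; rewrite /=; intuition.
  - have -> : j + l + i = i + j + l by ring.
    by rewrite E; clear; pt_ring.
have p3 : primitive3 r p s = true.
  apply: (@inner_triangle_primitive B r p q s l i j sB hB) => //; try lia.
  - by apply/NoDup4; split; split=> //; apply: not_eq_sym.
  - by move=> z hz; apply: iB; move: hz; rewrite /=; intuition.
  - have -> : l + i + j = i + j + l by ring.
    by rewrite E; clear; pt_ring.
move: p1 p2 p3; rewrite -(primitive3_rot s p q) -(primitive3_rot s q r).
rewrite -(primitive3_rot s r p).
set a := psub p s; set b := psub q s; set c := psub r s.
rewrite /primitive3 -/a -/b -/c => p1 p2 p3.
have R : padd (pscale i a) (padd (pscale j b) (pscale l c)) = o0.
  have -> : padd (pscale i a) (padd (pscale j b) (pscale l c)) =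
    psub (padd (pscale i p) (padd (pscale j q) (pscale l r))) (pscale (i + j + l) s).
    by rewrite /a /b /c; clear; pt_ring.
  by rewrite -E; clear; pt_ring.
have crossD u v w : cross u (padd v w) = padd (cross u v) (cross u w) by clear; pt_ring.
have il : i = l.
  apply: primitive_multiple p1 p2 hi hl _.
  have -> : pscale i (cross a b) = psub (pscale l (cross b c))
     (cross b (padd (pscale i a) (padd (pscale j b) (pscale l c)))) by clear; pt_ring.
  by rewrite R; clear; pt_ring.
have jl : j = l.
  apply: primitive_multiple p1 p3 hj hl _.
  have -> : pscale j (cross a b) = padd (pscale l (cross c a))
     (cross a (padd (pscale i a) (padd (pscale j b) (pscale l c)))) by clear; pt_ring.
  by rewrite R; clear; pt_ring.
apply: (pscaleI (a := l)); first lia.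
rewrite il jl in E.
have -> : pscale l (padd p (padd q r)) = padd (pscale l p) (padd (pscale l q) (pscale l r)).
  by clear; pt_ring.
by rewrite -E; clear; pt_ring.
Qed.

Lemma inlistP p l : inlist p l = true <-> In p l.
Proof.
rewrite /inlist; split; first by move=> /hasbP[x hx /peqP ->].
elim: l => [|x l IH] //= [->|/IH h]; last by case: peq.
by have -> : peq p p = true by apply/peqP.
Qed.

Lemma exists_not_in (X l : list pt) : NoDup X -> (length l < length X)%coq_nat ->
  exists2 x, In x X & ~ In x l.
Proof.
move=> nX hl; apply: contrapT => h.
have : incl X l.
  move=> x hx; apply/inlistP; case E: inlist => //; case: h; exists x => //.
  by move/inlistP; rewrite E.
by move/(NoDup_incl_length nX); lia.
Qed.

Definition third_vertex (X : list pt) : Prop := forall p q, In p X -> In q X -> p <> q ->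
  exists r, [/\ In r X, r <> p, r <> q & primitive3 p q r = true].

Lemma all_primitive_third_vertex X : NoDup X -> (3 <= length X)%coq_nat ->
  all_primitive X -> third_vertex X.
Proof.
move=> nX hX hp p q hpX hqX npq.
have [r hr nr] := @exists_not_in X [:: p; q] nX hX.
have rp : r <> p by move=> e; apply: nr; rewrite e /=; auto.
have rq : r <> q by move=> e; apply: nr; rewrite e /=; auto.
exists r; split=> //; apply: hp; first by apply/NoDup3; split=> //; apply: not_eq_sym.
by move=> z [<-|[<-|[<-|]]].
Qed.

(** If p, q, r is not unimodular, the fourth point lies inside it and serves as the third vertex
    instead. *)
Lemma sane_third_vertex B : sane B -> length B = 4%nat -> third_vertex B.
Proof.
move=> sB hB p q hp hq npq; have [nB cB gB] := sB.
have [|r hr nr] := @exists_not_in B [:: p; q] nB; first by rewrite hB /=; lia.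
have rp : r <> p by move=> e; apply: nr; rewrite e /=; auto.
have rq : r <> q by move=> e; apply: nr; rewrite e /=; auto.
case E: (primitive3 p q r); first by exists r.
have nd3 : NoDup [:: p; q; r] by apply/NoDup3; split=> //; apply: not_eq_sym.
have i3 : incl [:: p; q; r] B by move=> z [<-|[<-|[<-|]]].
have [s [i [j [l [hs ns [hi [hj hl]] h0 Es]]]]] := triangle_lattice_point cB gB nd3 i3 E.
have sp : s <> p by move=> e; apply: ns; rewrite e /=; auto.
have sq : s <> q by move=> e; apply: ns; rewrite e /=; auto.
have sr : s <> r by move=> e; apply: ns; rewrite e /=; auto.
exists s; split=> //.
apply: (inner_triangle_primitive (r := r) sB hB _ _ hi hj hl h0 Es).
  by apply/NoDup4; split; split=> //; apply: not_eq_sym.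
by move=> z [<-|[<-|[<-|[<-|]]]].
Qed.

Lemma all_primitive_centroid_rule X : all_primitive X -> centroid_rule X.
Proof.
move=> hp p q r s /NoDup4[[h1 h2 _] [h3 _ _]] iX.
rewrite hp //; first exact/NoDup3.
by move=> z hz; apply: iX; move: hz; rewrite /=; tauto.
Qed.

(** * Change of coordinates *)

Definition img (f : pt -> pt) (a : pt) (X : list pt) : list pt :=
  List.map (fun p => f (psub p a)) X.

Lemma psub_padd p q : psub (padd p q) q = p.
Proof. pt_ring. Qed.
Lemma padd_psub p q : padd (psub p q) q = p.
Proof. pt_ring. Qed.

Lemma psub_psub p q r : psub (psub p r) (psub q r) = psub p q.
Proof. pt_ring. Qed.

Section Coordinates.
Variables (f g : pt -> pt).
Hypothesis U : unimodular f g.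

(** Weights on the image are carried back to X along x -> g x + a, the inverse of the change of
    coordinates. *)
Definition pull (a : pt) (l : list (Z * pt)) : list (Z * pt) :=
  List.map (fun wp => (wp.1, padd (g wp.2) a)) l.

Lemma in_img a X p : In p X -> In (f (psub p a)) (img f a X).
Proof. exact: (in_map (fun p => f (psub p a))). Qed.
Lemma img_in a X p : In p (img f a X) -> In (padd (g p) a) X.
Proof.
have [_ _ fg _] := U; move=> /in_map_iff[q [<- hq]]; rewrite fg.
by rewrite padd_psub.
Qed.
Lemma mem_img_of_pull a X p : In (padd (g p) a) X -> In p (img f a X).
Proof.
have [_ _ _ gf] := U; move=> /(in_img a).
by rewrite psub_padd gf.
Qed.

Lemma wsum_pull a l : wsum (pull a l) = wsum l.
Proof. by elim: l => [|wp l IH] //=; rewrite IH. Qed.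
Lemma lcomb_pull a l : lcomb (pull a l) = padd (g (lcomb l)) (pscale (wsum l) a).
Proof.
have [_ hg _ _] := U.
elim: l => [|wp l IH] /=; first by rewrite linear_o0 //; clear; pt_ring.
rewrite IH hg.1 hg.2; move: (g wp.2) (g (lcomb l)) => p q; clear.
by case: wp => w x /=; pt_ring.
Qed.
Lemma wts_pull a X l : wts (img f a X) l -> wts X (pull a l).
Proof.
move=> h; apply/Forall_map; apply: Forall_impl h => wp [h1 h2].
by split=> //=; apply: img_in.
Qed.
Lemma g_pscale_lcomb l z : pscale (wsum l) z = lcomb l ->
  forall a, pscale (wsum (pull a l)) (padd (g z) a) = lcomb (pull a l).
Proof.
move=> E a; have [_ hg _ _] := U; rewrite wsum_pull lcomb_pull -E hg.2 pscaleDr.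
by [].
Qed.

Lemma padd_img_inj a p q : padd (g p) a = padd (g q) a -> p = q.
Proof.
move=> h; apply: (unimodular_inj (unimodular_sym U)).
by rewrite -(psub_padd (g p) a) h psub_padd.
Qed.

Lemma in_convex_position_img a A : in_convex_position A -> in_convex_position (img f a A).
Proof.
move=> hA l z hl hs E.
have := hA _ _ (wts_pull hl) _ (g_pscale_lcomb E a); rewrite wsum_pull => /(_ hs).
move/Forall_map; apply: Forall_impl => wp /= h /h.
exact: padd_img_inj.
Qed.

Lemma sane_img a X : sane X -> sane (img f a X).
Proof.
have [hf hg fg gf] := U; move=> [nX cX gX]; split.
- apply: NoDup_map_in => // p q _ _ /(unimodular_inj U) h.
  by rewrite -(padd_psub p a) h padd_psub.
- move=> z [l [hl hs E]]; apply: mem_img_of_pull; apply: cX; exists (pull a l).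
  by split; [exact: wts_pull|rewrite wsum_pull|exact: g_pscale_lcomb].
- move=> z u hu /img_in h0 /img_in h1 /img_in h2.
  apply: (gX (padd (g z) a) (g u)) => //.
  + by move=> h; apply: hu; apply: (unimodular_inj (unimodular_sym U)); rewrite h linear_o0.
  + by move: h1; rewrite hg.1; move: (g z) (g u); clear => p q;
      have -> : padd (padd p q) a = padd (padd p a) q by pt_ring.
  + by move: h2; rewrite hg.1 hg.2; move: (g z) (g u); clear => p q;
      have -> : padd (padd p (pscale 2 q)) a = padd (padd p a) (pscale 2 q) by pt_ring.
Qed.

Lemma insum_img a b A B z : insum (img f a A) (img f b B) z ->
  insum A B (padd (g z) (padd a b)).
Proof.
have [_ hg _ _] := U; move=> [l [m [hl hm hs e E]]]; exists (pull a l), (pull b m).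
split; [exact: wts_pull|exact: wts_pull|by rewrite wsum_pull|by rewrite !wsum_pull|].
rewrite wsum_pull !lcomb_pull e pscaleDr -hg.2 E hg.1.
by move: (g (lcomb l)) (g (lcomb m)); clear => p q; pt_ring.
Qed.

Lemma three_sum_img a b A B : three_sum (img f a A) (img f b B) -> three_sum A B.
Proof.
have [_ hg _ _] := U.
have nz u : u <> o0 -> g u <> o0.
  by move=> hu h; apply: hu; apply: (unimodular_inj (unimodular_sym U)); rewrite h linear_o0.
have tr z w : insum (img f a A) (img f b B) (padd z w) ->
    insum A B (padd (padd (g z) (padd a b)) (g w)).
  move=> /insum_img; rewrite hg.1.
  by rewrite (_ : padd (padd (g z) (g w)) _ = padd (padd (g z) (padd a b)) (g w)) //;
    move: (g z) (g w); clear => *; pt_ring.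
move=> [z [u [v [w [[h1 h2 h3] [[k1 k2 k3 k4] [k5 k6 k7 k8]]]]]]].
exists (padd (g z) (padd a b)), (g u), (g v), (g w).
split; first by split; apply: nz.
by split; split; rewrite -?hg.1; first exact: insum_img; exact: tr.
Qed.

Lemma det_bound_img k a b A B : det_bound k A B -> det_bound k (img f a A) (img f b B).
Proof.
have [hf _ _ _] := U.
move=> h ? ? ? ? ? /in_map_iff[x [<- hx]] /in_map_iff[y [<- hy]] /in_map_iff[z [<- hz]].
move=> /in_map_iff[p [<- hp]] /in_map_iff[q [<- hq]].
rewrite /primitive3 -!(linear_sub _ _ hf) !psub_psub (primitive_cross _ _ U) => pr.
have := det_unimodular (psub y x) (psub z x) (psub p q) U; rewrite /det => ->.
exact: h.
Qed.
End Coordinates.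

(** For a unimodular triangle the normal form has r = m = 1 and al = 0, so its edges become e1 and
    e2; a reflection then makes the height of v positive. *)
Lemma standard_coordinates a b c p q : primitive3 a b c = true ->
  dot (cross (psub b a) (psub c a)) (psub q p) <> 0 ->
  exists f g x y k, [/\ unimodular f g, f (psub b a) = e1, f (psub c a) = e2,
    f (psub q p) = (x, y, k) &
    [/\ k = Z.abs (dot (cross (psub b a) (psub c a)) (psub q p)), 0 < k, 0 <= x < k & 0 <= y < k]].
Proof.
set u := psub b a; set w := psub c a; set v := psub q p => pr D0.
have [f [g [r [al [m [U fu fw [hr hm] hal]]]]]] := normal_form u w.
have : primitive (cross (f u) (f w)) = true by rewrite (primitive_cross _ _ U).
rewrite fu fw => /primitiveP[z hz].
have hrm : r * m * z.2 = 1.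
  by rewrite -hz; case: z {hz} => [[z1 z2] z3]; rewrite /dot /cross; cbn [snd]; ring.
have [r1 m1] : r = 1 /\ m = 1.
  have h : r * m = 1 by case: (Z.mul_eq_1 _ _ hrm) => // e; nia.
  by case: (Z.mul_eq_1 _ _ h) => e; nia.
have al0 : al = 0 by have := hal; rewrite m1 => /(_ erefl); lia.
move: fu fw; rewrite r1 m1 al0 => fu fw.
have hD := det_unimodular u w v U; rewrite fu fw /det -/v in hD.
case Ev : (f v) hD => [[v1 v2] v3] hD.
have {}hD : Z.abs v3 = Z.abs (dot (cross u w) v).
  by rewrite -hD /dot /cross; congr Z.abs; ring.
have [f' [g' [v3' [U' fu' fw' fv' [h3 h3']]]]] : exists f' g' v3',
    [/\ unimodular f' g', f' u = e1, f' w = e2, f' v = (v1, v2, v3') &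
        v3' = Z.abs v3 /\ 0 < v3'].
  have v30 : v3 <> 0 by move=> e; apply: D0; move: hD; rewrite e; lia.
  have [h|h] : 0 < v3 \/ v3 < 0 by lia.
    by exists f, g, v3; split=> //; lia.
  exists (fun p => flip3 (f p)), (fun p => g (flip3 p)), (- v3); split; last lia.
  - exact: unimodular_comp U flip3_unimodular.
  - by rewrite fu.
  - by rewrite fw.
  - by rewrite Ev.
(* The shear fixes e1 and e2 and reduces the other coordinates of v modulo its height. *)
have S := shear_unimodular (v1 / v3') (v2 / v3').
exists (fun p => shear (v1 / v3') (v2 / v3') (f' p)).
exists (fun p => g' (shear (- (v1 / v3')) (- (v2 / v3')) p)).
exists (v1 mod v3'), (v2 mod v3'), v3'; split.
- exact: unimodular_comp U' S.
- by rewrite fu' /shear; apply: pt_ext; ring.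
- by rewrite fw' /shear; apply: pt_ext; ring.
- by rewrite fv' /shear; apply: pt_ext; rewrite ?Z.mod_eq; lia.
by split; [lia|by []|apply: Z.mod_pos_bound|apply: Z.mod_pos_bound].
Qed.

(** * The integral classification *)

Definition attained (A B : list pt) (k : Z) : Prop := exists a b c p q,
  [/\ In a A, In b A & In c A] /\ [/\ In p B, In q B, primitive3 a b c = true &
  k = Z.abs (dot (cross (psub b a) (psub c a)) (psub q p))].

Definition ES2 (A B : list pt) : Prop := exists a0 a1 a2 a3 a4 c,
  [/\ padd a1 (padd a2 a3) = padd a4 (padd a0 a0),
      Z.abs (det (psub a1 a0) (psub a2 a0) (psub a3 a0)) = 1,
      forall p, In p A <-> In p [:: a0; a1; a2; a3; a4] &
      forall p, In p B <-> In p (List.map (padd c) [:: a1; a2; a3; a4])].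

Lemma attained_le_44 A B k : ~ three_sum A B -> attained A B k -> k <= 44.
Proof.
move=> no3 [a [b [c [p [q [[ha hb hc] [hp hq pr ek]]]]]]].
case: (Z.eq_dec (dot (cross (psub b a) (psub c a)) (psub q p)) 0) => [e|D0].
  by rewrite ek e.
have [f [g [x [y [k' [U fb fc fq [ek' k0 hx hy]]]]]]] := standard_coordinates pr D0.
have [hf _ _ _] := U.
have f0 t : f (psub t t) = o0.
  by have -> : psub t t = o0 by [clear; pt_ring]; rewrite linear_o0.
rewrite ek -ek'; apply: (@det_le_44 (img f a A) (img f p B) x y k').
- by move/(three_sum_img U).
- by rewrite -(f0 a); apply: in_img.
- by rewrite -fb; apply: in_img.
- by rewrite -fc; apply: in_img.
- by rewrite -(f0 p); apply: in_img.
- by rewrite -fq; apply: in_img.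
Qed.

Lemma max_exists (P : Z -> Prop) K k0 : P k0 -> (forall k, P k -> k <= K) ->
  exists2 k, P k & forall k', P k' -> k' <= k.
Proof.
move=> h0 hK; have : K - k0 <= Z.of_nat (Z.to_nat (K - k0)) by lia.
move: (Z.to_nat _) => n; elim: n k0 h0 => [|n IH] k0 h0 hn.
  by exists k0 => // k' /hK; lia.
have [[k' [h1 h2]]|h] := EM (exists k', P k' /\ k0 < k').
  by apply: (IH k') => //; lia.
exists k0 => // k' hk'; case: (Z.le_gt_cases k' k0) => // h'.
by case: h; exists k'.
Qed.

Lemma search_standard X Y k x y : ~ three_sum X Y -> sane X -> sane Y ->
  centroid_rule X -> centroid_rule Y -> third_vertex Y ->
  det_bound k X Y -> det_bound k Y X ->
  In o0 X -> In e1 X -> In e2 X -> In o0 Y -> In (x, y, k) Y ->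
  0 < k -> 0 <= x < k -> 0 <= y < k ->
  exists2 w, In w Y /\ NoDup [:: o0; (x, y, k); w] & forall a b,
  In a X -> ~ In a [:: o0; e1; e2] -> In b Y -> ~ In b [:: o0; (x, y, k); w] ->
  (forall a', In a' X -> ~ In a' [:: o0; e1; e2] -> a <> a' ->
     good [:: o0; e1; e2; a; a'] [:: o0; (x, y, k); w; b] = true) /\
  (forall b', In b' Y -> ~ In b' [:: o0; (x, y, k); w] -> b <> b' ->
     good [:: o0; (x, y, k); w; b; b'] [:: o0; e1; e2; a] = true).
Proof.
move=> no3 sX sY cX cY tY hX hY X0 X1 X2 Y0 Yv hk hx hy.
have k44 := det_le_44 no3 X0 X1 X2 Y0 Yv.
have nv : o0 <> (x, y, k) by move=> /pt_inv[_ _ e]; lia.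
have hh : hex k x y = false.
  by case E: hex => //; case: no3; apply: hex_sound E.
have hg : Z.gcd (Z.gcd x y) k = 1.
  set d := Z.gcd _ k.
  have [k' hk'] : (d | k) by apply: Z.gcd_divide_r.
  have [m hm] : (d | Z.gcd x y) by apply: Z.gcd_divide_l.
  have [x' hx'] := Z.gcd_divide_l x y; have [y' hy'] := Z.gcd_divide_r x y.
  have d0 : 0 <= d by apply: Z.gcd_nonneg.
  (* For d > 1 the lattice point v / d would lie strictly between 0 and v. *)
  case: (Z.eq_dec d 1) => // d1; exfalso; have [_ cl np] := sY.
  have dn0 : d <> 0 by move=> e; move: hk'; rewrite e; lia.
  apply: (not_between (x := o0) (y := (x, y, k)) (z := (x' * m, y' * m, k'))
    (i := d - 1) (j := 1) cl np) => //; try lia.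
  - by move=> /pt_inv[_ _ e]; nia.
  - by move=> /pt_inv[_ _ e]; nia.
  - rewrite /pscale /o0 /padd; apply: pt_ext; last lia.
      by transitivity (x' * (m * d)); [ring|rewrite -hm -hx'; ring].
    by transitivity (y' * (m * d)); [ring|rewrite -hm -hy'; ring].
have hc : check k x y = true.
  have cr k0 n : check_range k0 n = true -> In k (upto n k0) -> check k x y = true.
    move=> /allbP h /h /allbP /(_ x) h'.
    have /h' /allbP /(_ y) : In x (upto (Z.to_nat k) 0) by apply/in_upto; lia.
    by apply; apply/in_upto; lia.
  have [h|h] : k <= 14 \/ 15 <= k by lia.
    by apply: (cr _ _ check_range_1_14); apply/in_upto; lia.
  by apply: (cr _ _ check_range_15_44); apply/in_upto; lia.
have [w [hw w0 wv pw]] := tY _ _ Y0 Yv nv.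
have ndw : NoDup [:: o0; (x, y, k); w] by apply/NoDup3; split=> //; apply: not_eq_sym.
exists w; first by [].
move=> a b ha na hb nb.
have pw' : primitive (cross (x, y, k) w) = true by rewrite -pw /primitive3 !psub_o0.
have [h1 h2] := search hk no3 hX hY cX cY X0 X1 X2 Y0 Yv hc hg hh hw pw' ha na hb
  (NoDup_cons _ nb ndw).
by split=> // b' hb' nb'; apply: h2 => //; constructor.
Qed.

Lemma splits_perm (T : Type) (l : list T) xl : In xl (splits l) -> Permutation l (xl.1 :: xl.2).
Proof.
elim: l xl => [|x l IH] xl; first by [].
move=> [<-|/in_map_iff[yl [<- /IH h]]] /=; first exact: Permutation_refl.
by apply: (Permutation_trans (perm_skip x h)); apply: perm_swap.
Qed.

Lemma in_tetrahedron_sound A l : in_convex_position A -> NoDup l -> incl l A ->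
  in_tetrahedron l = false.
Proof.
move=> hA nl il; case E: in_tetrahedron => //.
move: E => /hasbP[[z [|a [|b [|c [|d [|? ?]]]]]] /splits_perm /= hp] //.
have iA x : In x [:: z; a; b; c; d] -> In x A.
  by move=> hx; apply: il; apply: Permutation_in (Permutation_sym hp) hx.
have nz : ~ In z [:: a; b; c; d].
  by have := Permutation_NoDup hp nl; move/NoDup_cons_iff => [].
have [ha hb hc hd] : [/\ In a A, In b A, In c A & In d A] by split; apply: iA => /=; auto 10.
set D := det (psub b a) _ _; set s := Z.sgn D.
set db := s * det (psub z a) _ _; set dc := s * det _ (psub z a) _.
set dd := s * det _ _ (psub z a).
case: Z.eqb_spec => // D0; case: Z.ltb_spec => // h1; case: Z.ltb_spec => // h2.
case: Z.ltb_spec => // h3; move/Z.leb_le => h4.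
have hsD : 0 < s * D by have := Z.sgn_abs D; rewrite -/s; lia.
pose l' := [:: (s * D - (db + dc + dd), a); (db, b); (dc, c); (dd, d)].
have el : wsum l' = s * D by rewrite /l' /=; ring.
have h : Forall (fun wp => 0 < wp.1 -> wp.2 = z) l'.
  apply: hA; [by wts_tac|by rewrite el|rewrite el /l' /db /dc /dd /D].
  by clearbody s; clear; cbn [lcomb fst snd]; pt_ring.
have hl' : wts A l' by wts_tac.
have hs' : 0 < wsum l' by rewrite el.
have [[w x] hx /= hw] := positive_weight hl' hs'.
have := h; rewrite List.Forall_forall => /(_ _ hx hw) /= e; exfalso; apply: nz; rewrite -e.
by case: hx => [[_ <-]|[[_ <-]|[[_ <-]|[[_ <-]|//]]]] /=; auto 10.
Qed.

Lemma is_ES2_sound A B : NoDup A -> NoDup B -> length B = 4%nat ->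
  is_ES2 A B = true -> ES2 A B.
Proof.
move=> nA nB hB /hasbP[[a0 l] /splits_perm /= p1].
move=> /hasbP[[a4 [|a1 [|a2 [|a3 [|? ?]]]]] /splits_perm /= p2] //.
case E1: peq => //; move/peqP: E1 => E1.
case: Z.eqb_spec => // E2 /hasbP[b hb]; cbv zeta; set c := psub b a4 => hall.
have h := allbP (hall : allb (fun a => inlist (padd a c) B) [:: a1; a2; a3; a4] = true).
have p3 : Permutation A [:: a0; a1; a2; a3; a4].
  apply: Permutation_trans p1 _; apply: perm_skip; apply: Permutation_trans p2 _.
  exact: (Permutation_app_comm [:: a4] [:: a1; a2; a3]).
have n4 : NoDup [:: a1; a2; a3; a4].
  by have := Permutation_NoDup p3 nA => /NoDup_cons_iff[].
exists a0, a1, a2, a3, a4, c; split=> // p.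
  by split=> hp; [apply: Permutation_in p3 _|apply: Permutation_in (Permutation_sym p3) _].
have nm : NoDup (List.map (padd c) [:: a1; a2; a3; a4]).
  apply: NoDup_map_in => // x y _ _ e.
  have eq t : t = psub (padd c t) c by clear; pt_ring.
  by rewrite (eq x) (eq y) e.
have im : incl (List.map (padd c) [:: a1; a2; a3; a4]) B.
  move=> q /in_map_iff[x [<- /h /inlistP]].
  by have -> : padd x c = padd c x by clear; pt_ring.
split; last exact: im.
by apply: (NoDup_length_incl nm _ im); rewrite hB.
Qed.

Lemma ES2_ext A B A' B' : (forall p, In p A <-> In p A') -> (forall p, In p B <-> In p B') ->
  ES2 A B -> ES2 A' B'.
Proof.
move=> hA hB [a0 [a1 [a2 [a3 [a4 [c [h1 h2 h3 h4]]]]]]].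
by exists a0, a1, a2, a3, a4, c; split=> // p; [rewrite -hA h3|rewrite -hB h4].
Qed.

Lemma same_elements (X l : list pt) : NoDup l -> incl l X -> (length X <= length l)%coq_nat ->
  forall p, In p l <-> In p X.
Proof. by move=> nl il hl p; split; [exact: il|exact: (NoDup_length_incl nl hl il)]. Qed.

Lemma ES2_img f g a b A B : unimodular f g -> ES2 (img f a A) (img f b B) -> ES2 A B.
Proof.
move=> U [a0 [a1 [a2 [a3 [a4 [c [h1 h2 h3 h4]]]]]]]; have [hf hg fg gf] := U.
pose t p := padd (g p) a.
have tD p q : psub (t p) (t q) = g (psub p q).
  by rewrite linear_sub // /t; move: (g p) (g q); clear => *; pt_ring.
exists (t a0), (t a1), (t a2), (t a3), (t a4), (psub (padd (g c) b) a); split.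
- have e : padd (g a1) (padd (g a2) (g a3)) = padd (g a4) (padd (g a0) (g a0)).
    by rewrite -!hg.1 h1.
  have -> : padd (t a1) (padd (t a2) (t a3)) =
     padd (padd (g a1) (padd (g a2) (g a3))) (padd a (padd a a)).
    by rewrite /t; move: (g a1) (g a2) (g a3); clear => *; pt_ring.
  by rewrite e /t; move: (g a4) (g a0); clear => *; pt_ring.
- by rewrite !tD (det_unimodular _ _ _ (unimodular_sym U)).
- move=> p; have -> : In p [:: t a0; t a1; t a2; t a3; t a4] <->
      In (f (psub p a)) [:: a0; a1; a2; a3; a4].
    rewrite -[[:: t a0; _; _; _; _]]/(List.map t [:: a0; a1; a2; a3; a4]) in_map_iff.
    split=> [[x [<- hx]]|h]; first by rewrite /t psub_padd gf.
    by exists (f (psub p a)); rewrite /t fg padd_psub.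
  rewrite -h3; split; first exact: in_img.
  by move=> /(img_in U); rewrite fg padd_psub.
- move=> p; have -> : In p (List.map (padd (psub (padd (g c) b) a)) [:: t a1; t a2; t a3; t a4])
      <-> In (f (psub p b)) (List.map (padd c) [:: a1; a2; a3; a4]).
    rewrite -[[:: t a1; _; _; _]]/(List.map t [:: a1; a2; a3; a4]) List.map_map !in_map_iff.
    have e x : padd (psub (padd (g c) b) a) (t x) = padd (g (padd c x)) b.
      by rewrite hg.1 /t; move: (g c) (g x); clear => *; pt_ring.
    split=> [[x [<- hx]]|[x [ex hx]]]; exists x; split=> //.
      by rewrite e psub_padd gf.
    by rewrite e ex fg padd_psub.
  rewrite -h4; split; first exact: in_img.
  by move=> /(img_in U); rewrite fg padd_psub.
Qed.

(** In a plane there are only four classes modulo 2, so two of five points have a lattice point as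
    midpoint, against convex position. *)
Lemma not_coplanar A n : in_convex_position A -> NoDup A -> length A = 5%nat ->
  forall u w, n = cross u w -> primitive n = true ->
  exists a b, [/\ In a A, In b A & dot n (psub a b) <> 0].
Proof.
move=> hA nA lA u w -> pr; apply: contrapT => hn.
have [f [g [r [al [m [U fu fw _ _]]]]]] := normal_form u w.
have [hf hg fg gf] := U.
have hrm : r * m <> 0.
  move=> e; move: pr; rewrite -(primitive_cross _ _ U) fu fw => /primitiveP[[[z1 z2] z3]].
  have -> : dot (cross (r, 0, 0) (al, m, 0)) (z1, z2, z3) = r * m * z3.
    by rewrite /dot /cross; ring.
  by rewrite e.
have flat a b : In a A -> In b A -> (f (psub a b)).2 = 0.
  move=> ha hb; have d0 : dot (cross u w) (psub a b) = 0.
    by apply: contrapT => h; apply: hn; exists a, b.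
  have := det_unimodular u w (psub a b) U; rewrite /det d0 fu fw.
  case: (f (psub a b)) => [[x y] z]; rewrite /dot /cross; cbn [snd] => h.
  have {}h : r * m * z = 0 by lia.
  by case: (Z.mul_eq_0_r _ _ h hrm).
pose par p := (f p).1.1 mod 2 + 2 * ((f p).1.2 mod 2).
have npar : NoDup (List.map par A).
  apply: NoDup_map_in => // a b ha hb e.
  have [x [y [Ex Ey]]] : exists x y, (f a).1.1 = (f b).1.1 + 2 * x /\
      (f a).1.2 = (f b).1.2 + 2 * y.
    exists (((f a).1.1 - (f b).1.1) / 2), (((f a).1.2 - (f b).1.2) / 2).
    by move: e; rewrite /par; Z.to_euclidean_division_equations; lia.
  have Eab : f a = padd (f b) (pscale 2 (x, y, 0)).
    have := flat a b ha hb; rewrite linear_sub //; move: Ex Ey.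
    case: (f a) => [[a1 a2] a3]; case: (f b) => [[b1 b2] b3]; rewrite /psub.
    by cbn [fst snd] => -> -> h; rewrite /padd /pscale; apply: pt_ext; lia.
  have Ea : a = padd b (pscale 2 (g (x, y, 0))).
    by rewrite -(fg a) Eab hg.1 hg.2 fg.
  have h : Forall (fun wp => 0 < wp.1 -> wp.2 = padd b (g (x, y, 0))) [:: (1, a); (1, b)].
    apply: hA; [by wts_tac|by []|].
    by cbn [wsum lcomb fst snd]; rewrite Ea; move: (g _); clear => *; pt_ring.
  have e1 := List.Forall_inv h erefl.
  have e2 := List.Forall_inv (List.Forall_inv_tail h) erefl.
  exact: (etrans e1 (esym e2)).
have ipar : incl (List.map par A) (upto 4 0).
  move=> z /in_map_iff[a [<- _]]; apply/in_upto; rewrite /par.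
  have := Z.mod_pos_bound (f a).1.1 2; have := Z.mod_pos_bound (f a).1.2 2; lia.
by have := NoDup_incl_length npar ipar; rewrite List.length_map lA /=; lia.
Qed.

Lemma img_length f a X : length (img f a X) = length X.
Proof. exact: List.length_map. Qed.

Lemma NoDup_app5 (a b c d e : pt) : NoDup [:: a; b; c] -> ~ In d [:: a; b; c] ->
  ~ In e [:: a; b; c] -> d <> e -> NoDup [:: a; b; c; d; e].
Proof.
move=> h hd he n; apply: (Permutation_NoDup (Permutation_app_comm [:: d; e] [:: a; b; c])).
by constructor=> [[e'|]|] //; [exact: (not_eq_sym n)|constructor].
Qed.
Lemma NoDup_app4 (a b c d : pt) : NoDup [:: a; b; c] -> ~ In d [:: a; b; c] ->
  NoDup [:: a; b; c; d].
Proof.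
move=> h hd; apply: (Permutation_NoDup (Permutation_app_comm [:: d] [:: a; b; c])).
by constructor.
Qed.

Definition rigid (X : list pt) : Prop := centroid_rule X /\ third_vertex X.

Lemma det_bound_of_max A B k : (forall k', attained A B k' -> k' <= k) -> det_bound k A B.
Proof. by move=> h a b c p q *; apply: h; exists a, b, c, q, p. Qed.

(** It is applied both to (A, B) and to (B, A); hence [rigid] is all that it asks of the triangles
    of either set, and both kinds of extension appear in the conclusion. *)
Lemma maximal_coordinates A B k : sane A -> sane B -> ~ three_sum A B ->
  (forall f g a, unimodular f g -> rigid (img f a A)) ->
  (forall f g a, unimodular f g -> rigid (img f a B)) ->
  attained A B k -> 0 < k -> det_bound k A B -> det_bound k B A ->
  exists f g a p v w, [/\ unimodular f g, incl [:: o0; e1; e2] (img f a A),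
    incl [:: o0; v; w] (img f p B), NoDup [:: o0; v; w] &
    forall a0 b, In a0 (img f a A) -> ~ In a0 [:: o0; e1; e2] ->
      In b (img f p B) -> ~ In b [:: o0; v; w] ->
    (forall a1, In a1 (img f a A) -> ~ In a1 [:: o0; e1; e2] -> a0 <> a1 ->
      good [:: o0; e1; e2; a0; a1] [:: o0; v; w; b] = true) /\
    (forall b1, In b1 (img f p B) -> ~ In b1 [:: o0; v; w] -> b <> b1 ->
      good [:: o0; v; w; b; b1] [:: o0; e1; e2; a0] = true)].
Proof.
move=> sA sB no3 rA rB [a [b [c [p [q [[ha hb hc] [hp hq pr ek]]]]]]] hk hAB hBA.
have [|f [g [x [y [k' [U fb fc fq [ek' k0 hx hy]]]]]]] := standard_coordinates pr (q := q) (p := p).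
  by move=> e; move: ek; rewrite e /=; lia.
rewrite -ek in ek'; rewrite ek' in fq k0 hx hy.
have [hf _ _ _] := U.
have f0 t : f (psub t t) = o0.
  by have -> : psub t t = o0 by [clear; pt_ring]; rewrite linear_o0.
have X0 : In o0 (img f a A) by rewrite -(f0 a); apply: in_img.
have X1 : In e1 (img f a A) by rewrite -fb; apply: in_img.
have X2 : In e2 (img f a A) by rewrite -fc; apply: in_img.
have Y0 : In o0 (img f p B) by rewrite -(f0 p); apply: in_img.
have Yv : In (x, y, k) (img f p B) by rewrite -fq; apply: in_img.
have [cA _] := rA f g a U; have [cB tB] := rB f g p U.
have [w [hw ndw] h] := search_standard (fun t => no3 (three_sum_img U t)) (sane_img U a sA)
  (sane_img U p sB) cA cB tB (det_bound_img U hAB) (det_bound_img U hBA) X0 X1 X2 Y0 Yv k0 hx hy.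
exists f, g, a, p, (x, y, k), w; split=> // z; first by case=> [<-|[<-|[<-|]]].
by case=> [<-|[<-|[<-|]]].
Qed.

Lemma std_NoDup : NoDup [:: o0; e1; e2].
Proof. exact/NoDup3. Qed.

Theorem integer_classification A B : NoDup A -> length A = 5%nat -> in_convex_position A ->
  sane B -> length B = 4%nat -> ~ three_sum A B -> ES2 A B.
Proof.
move=> nA lA hA sB lB no3.
have cA := in_convex_position_closed hA.
have sA : sane A by split=> //; exact: in_convex_position_no_progression.
have rA f g a : unimodular f g -> rigid (img f a A).
  move=> U; have [nA' _ _] := sane_img U a sA.
  have pA := in_convex_position_primitive (in_convex_position_img U (a := a) hA).
  split; first exact: all_primitive_centroid_rule.
  by apply: all_primitive_third_vertex => //; rewrite img_length lA; lia.
have lB' f p : length (img f p B) = 4%nat by rewrite img_length.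
have rB f g p : unimodular f g -> rigid (img f p B).
  move=> U; have sB' := sane_img U p sB.
  by split; [exact: sane_centroid_rule|exact: sane_third_vertex].
have no3' : ~ three_sum B A by move/three_sum_sym.
(* The maximum must be positive for coordinates to exist: B has a unimodular triangle, and A does
   not lie in a plane parallel to it. *)
have [k0 [k00 hk0]] : exists k, 0 < k /\ attained B A k.
  have [nB _ _] := sB; have tB := sane_third_vertex sB lB.
  have [|p hp _] := @exists_not_in B nil nB; first by rewrite lB /=; lia.
  have [|q hq nq] := @exists_not_in B [:: p] nB; first by rewrite lB /=; lia.
  have npq : p <> q by move=> e; apply: nq; left.
  have [r [hr _ _ pr]] := tB p q hp hq npq.
  have [a [b [ha hb D]]] := not_coplanar hA nA lA erefl pr.
  exists (Z.abs (dot (cross (psub q p) (psub r p)) (psub a b))); split; first lia.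
  by exists p, q, r, b, a.
have [|k hk hmax] := @max_exists (fun k => attained A B k \/ attained B A k) 44 k0 (or_intror hk0).
  by move=> k [|]; apply: attained_le_44.
have kpos : 0 < k by have := hmax _ (or_intror hk0); lia.
have bAB := det_bound_of_max (fun k' h => hmax k' (or_introl h)).
have bBA := det_bound_of_max (fun k' h => hmax k' (or_intror h)).
(* Convex position excludes the first alternative of [good]; by counting, X and Y are all of the
   images of A and B. *)
have conclude f g a p X Y : unimodular f g -> NoDup X -> NoDup Y ->
    incl X (img f a A) -> incl Y (img f p B) -> length X = 5%nat -> length Y = 4%nat ->
    good X Y = true -> ES2 A B.
  move=> U nX nY iX iY lX lY; rewrite /good.
  rewrite (in_tetrahedron_sound (in_convex_position_img U (a := a) hA) nX iX).
  move=> /(is_ES2_sound nX nY lY) h; apply: (ES2_img U (a := a) (b := p)).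
  apply: ES2_ext h; apply: same_elements => //; rewrite img_length.
    by rewrite lA lX.
  by rewrite lB lY.
have sub (x1 x2 x3 : pt) X (l : list pt) : incl [:: x1; x2; x3] X -> incl l X ->
    incl (app [:: x1; x2; x3] l) X.
  by move=> h h' t /in_app_iff[/h|/h'].
have cons1 (z : pt) X : In z X -> incl [:: z] X by move=> hz t [<-|].
have cons2 (z z' : pt) X : In z X -> In z' X -> incl [:: z; z'] X by move=> hz hz' t [<-|[<-|]].
case: hk => hk.
- have [f [g [a [p [v [w [U iX iY nw h]]]]]]] :=
    maximal_coordinates sA sB no3 rA rB hk kpos bAB bBA.
  have [nX _ _] := sane_img U a sA; have [nY _ _] := sane_img U p sB.
  have [|a0 h0 n0] := @exists_not_in _ [:: o0; e1; e2] nX; first by rewrite img_length lA /=; lia.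
  have [|a1 h1 n1] := @exists_not_in _ [:: a0; o0; e1; e2] nX.
    by rewrite img_length lA /=; lia.
  have [|b hb nb] := @exists_not_in _ [:: o0; v; w] nY; first by rewrite img_length lB /=; lia.
  have n01 : a0 <> a1 by move=> e; apply: n1; left.
  have n1' : ~ In a1 [:: o0; e1; e2] by move=> e; apply: n1; right.
  have [/(_ a1 h1 n1' n01) hgood _] := h a0 b h0 n0 hb nb.
  apply: (conclude f g a p _ _ U _ _ _ _ _ _ hgood) => //.
  + exact: NoDup_app5 std_NoDup n0 n1' n01.
  + exact: NoDup_app4 nw nb.
  + exact: sub iX (cons2 _ _ _ h0 h1).
  + exact: sub iY (cons1 _ _ hb).
(* Here the triangle lies in B, and the second half of the conclusion takes the two further points
   from A. *)
have [f [g [p [a [v [w [U iY iX nw h]]]]]]] := maximal_coordinates sB sA no3' rB rA hk kpos bBA bAB.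
have [nX _ _] := sane_img U a sA; have [nY _ _] := sane_img U p sB.
have [|b hb nb] := @exists_not_in _ [:: o0; e1; e2] nY; first by rewrite img_length lB /=; lia.
have [|a0 h0 n0] := @exists_not_in _ [:: o0; v; w] nX; first by rewrite img_length lA /=; lia.
have [|a1 h1 n1] := @exists_not_in _ [:: a0; o0; v; w] nX; first by rewrite img_length lA /=; lia.
have n01 : a0 <> a1 by move=> e; apply: n1; left.
have n1' : ~ In a1 [:: o0; v; w] by move=> e; apply: n1; right.
have [_ /(_ a1 h1 n1' n01) hgood] := h b a0 hb nb h0 n0.
apply: (conclude f g a p _ _ U _ _ _ _ _ _ hgood) => //.
- exact: NoDup_app5 nw n0 n1' n01.
- exact: NoDup_app4 std_NoDup nb.
- exact: sub iX (cons2 _ _ _ h0 h1).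
- exact: sub iY (cons1 _ _ hb).
Qed.

(** * Back to real polytopes *)

Local Close Scope Z_scope.
Local Open Scope classical_set_scope.
Local Open Scope card_scope.
Local Open Scope ring_scope.

(** * Convex hulls and sums of lattice segments *)

Section ConvexHulls.
Variables (R : realType) (n : nat).
Local Notation V := 'cV[R]_n.
Implicit Types (P Q A : set V) (x y d : V) (t : R).

Lemma convex_setP P : convex_set P <->
  (forall x y t, P x -> P y -> 0 <= t -> t <= 1 -> P (t *: x + (1 - t) *: y)).
Proof.
split=> [h x y t Px Py t0 t1|h x y t].
  by have := h x y (Itv01 t0 t1); rewrite !in_setE; apply.
by rewrite !in_setE => Px Py; apply: h.
Qed.

Lemma convex_conv_hull A : convex_set (conv_hull A).
Proof.
apply/convex_setP => x y t hx hy t0 t1 C [cC AC].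
by move/convex_setP: (cC); apply=> //; [apply: hx|apply: hy].
Qed.

Lemma sub_conv_hull A : A `<=` conv_hull A.
Proof. exact: sub_gen_smallest. Qed.

Lemma conv_hull_min A P : convex_set P -> A `<=` P -> conv_hull A `<=` P.
Proof. exact: smallest_sub. Qed.

Lemma convex_translate P d : convex_set P -> convex_set [set x | P (x + d)].
Proof.
move=> /convex_setP h; apply/convex_setP => x y t /= Px Py t0 t1.
have -> : t *: x + (1 - t) *: y + d = t *: (x + d) + (1 - t) *: (y + d).
  by rewrite !scalerDr addrACA -scalerDl subrKC scale1r.
exact: h.
Qed.

Lemma convex_minkowski_add P Q : convex_set P -> convex_set Q ->
  convex_set (minkowski_add P Q).
Proof.
move=> /convex_setP hP /convex_setP hQ; apply/convex_setP => ? ? t [x Px [y Qy <-]].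
move=> [x' Px' [y' Qy' <-]] t0 t1; exists (t *: x + (1 - t) *: x'); first exact: hP.
by exists (t *: y + (1 - t) *: y'); [exact: hQ|rewrite !scalerDr addrACA].
Qed.

Lemma conv_hull_affine (M : 'M[R]_n) d A :
  [set M *m x + d | x in conv_hull A] = conv_hull [set M *m x + d | x in A].
Proof.
have aff x y t : M *m (t *: x + (1 - t) *: y) + d =
    t *: (M *m x + d) + (1 - t) *: (M *m y + d).
  by rewrite mulmxDr -!scalemxAr !scalerDr addrACA -scalerDl subrKC scale1r.
apply/seteqP; split=> [_ [x hx <-]|].
  have : conv_hull A `<=` [set x | conv_hull [set M *m x + d | x in A] (M *m x + d)].
    apply: conv_hull_min => [|y Ay]; last by apply: sub_conv_hull; exists y.
    apply/convex_setP => y z t /= hy hz t0 t1; rewrite aff.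
    by move/convex_setP: (convex_conv_hull (A := [set M *m x + d | x in A])); apply.
  exact.
apply: conv_hull_min => [|_ [y Ay <-]]; last by exists y => //; exact: sub_conv_hull.
apply/convex_setP => ? ? t [y hy <-] [z hz <-] t0 t1.
exists (t *: y + (1 - t) *: z); last exact: aff.
by move/convex_setP: (convex_conv_hull (A := A)); apply.
Qed.

Lemma lattice_polytope_convex P : lattice_polytope P -> convex_set P.
Proof. by move=> [A [_ _ ->]]; exact: convex_conv_hull. Qed.

Definition segment_at (s u : 'cV[int]_n) : set V :=
  conv_hull (@of_lattice R n @` [set s; s + u]).

Lemma lattice_polytope_segment s u : lattice_polytope (segment_at s u).
Proof. by exists [set s; s + u]; split=> //; exists s; left. Qed.

Lemma of_latticeD (z w : 'cV[int]_n) : of_lattice R (z + w) = of_lattice R z + of_lattice R w.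
Proof. exact: map_mxD. Qed.
Lemma of_lattice_inj : injective (@of_lattice R n).
Proof.
move=> z w /matrixP h; apply/matrixP => i j.
by have := h i j; rewrite !mxE => /intr_inj.
Qed.
Lemma of_lattice0 : of_lattice R (0 : 'cV[int]_n) = 0.
Proof. exact: map_mx0. Qed.

Lemma affine_dim_segment s u : u != 0 -> (0 < affine_dim (segment_at s u))%N.
Proof.
move=> u0; have n0 : (0 < n)%N.
  case: n u u0 => // u'; rewrite (_ : u' = 0) ?eqxx //.
  by apply/matrixP => -[].
have one : (1 < n.+1)%N by [].
apply: (@leq_trans (Ordinal one)) => //.
apply: (@leq_bigmax_cond _ _ (fun k : 'I_n.+1 => nat_of_ord k) (Ordinal one)).
apply/asboolP; exists (of_lattice R s), (of_lattice R u); split.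
- by apply: sub_conv_hull; exists s => //; left.
- move=> j; have -> : col j (of_lattice R u) = of_lattice R u.
    by apply/matrixP => i k; rewrite !mxE !ord1.
  by rewrite -of_latticeD; apply: sub_conv_hull; exists (s + u) => //; right.
- apply/eqP; rewrite -mxrank_tr eqn_leq rank_leq_row lt0n mxrank_eq0 trmx_eq0.
  by rewrite -of_lattice0 (inj_eq of_lattice_inj).
Qed.

(** The translation d holds the other summands, so that the segments of a sum can be reduced to
    their endpoints one at a time. *)
Lemma segment_at_sub P s u d : convex_set P ->
  (forall a, [set s; s + u] a -> P (of_lattice R a + d)) ->
  forall x, segment_at s u x -> P (x + d).
Proof.
move=> cP h; have : segment_at s u `<=` [set x | P (x + d)].
  by apply: conv_hull_min => [|_ [y hy <-]]; [exact: convex_translate|exact: h].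
exact.
Qed.

Lemma contains_two_segments P z u v : convex_set P -> u != 0 -> v != 0 ->
  (forall a b, [set z; z + u] a -> [set 0; 0 + v] b -> P (of_lattice R (b + a))) ->
  contains_minkowski_sum P 2.
Proof.
move=> cP u0 v0 h.
exists (fun i => if val i is 0%N then segment_at z u else segment_at 0 v); split.
  by move=> [[|[|//]] hi] /=; split;
    do ?[exact: lattice_polytope_segment|exact: affine_dim_segment].
rewrite !big_ord_recl big_ord0 /= => _ [x hx [_ [y hy [_ -> <-]] <-]].
rewrite addr0; apply: segment_at_sub hx => // a ha; rewrite addrC.
by apply: segment_at_sub hy => // b hb; rewrite -of_latticeD; exact: h.
Qed.

Lemma contains_three_segments P z u v w : convex_set P -> u != 0 -> v != 0 -> w != 0 ->
  (forall a b c, [set z; z + u] a -> [set 0; 0 + v] b -> [set 0; 0 + w] c ->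
    P (of_lattice R (c + (b + a)))) ->
  contains_minkowski_sum P 3.
Proof.
move=> cP u0 v0 w0 h.
exists (fun i => match val i with 0%N => segment_at z u | 1%N => segment_at 0 v
                             | _ => segment_at 0 w end); split.
  by move=> [[|[|[|//]]] hi] /=; split;
    do ?[exact: lattice_polytope_segment|exact: affine_dim_segment].
rewrite !big_ord_recl big_ord0 /= => _ [x hx [_ [y hy [_ [t ht [_ -> <-]] <-]] <-]].
rewrite addr0; apply: segment_at_sub hx => // a ha; rewrite addrC -addrA.
apply: segment_at_sub hy => // b hb; rewrite addrCA.
by apply: segment_at_sub ht => // c hc; rewrite -!of_latticeD; exact: h.
Qed.
End ConvexHulls.

(** * Integer triples as lattice points of real polytopes *)

Section LatticePoints.
Variable R : realType.
Implicit Types (P Q : set 'cV[R]_3) (p q : pt) (k : Z).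

Definition int_pt p : 'cV[int]_3 :=
  \col_i int_of_Z (nth Z0 [:: p.1.1; p.1.2; p.2] i).
Definition pt_int (z : 'cV[int]_3) : pt :=
  (Z_of_int (z 0 0), Z_of_int (z 1 0), Z_of_int (z (2%:R : 'I_3) 0)).
Definition real_pt p : 'cV[R]_3 := of_lattice R (int_pt p).
Definition real_Z k : R := (int_of_Z k)%:~R.

Lemma int_ptK : cancel int_pt pt_int.
Proof. by move=> [[a b] c]; rewrite /pt_int !mxE /= !int_of_ZK. Qed.
Lemma pt_intK : cancel pt_int int_pt.
Proof.
move=> z; apply/matrixP => i j; rewrite !mxE !ord1.
by case: i => [[|[|[|//]]] hi] /=; rewrite Z_of_intK; congr (z _ _); exact: val_inj.
Qed.

Lemma int_ptD p q : int_pt (padd p q) = int_pt p + int_pt q.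
Proof.
apply/matrixP => i j; rewrite !mxE; case: p => [[a b] c]; case: q => [[x y] z].
by case: i => [[|[|[|//]]] hi] /=; rewrite raddfD.
Qed.
Lemma int_pt0 : int_pt o0 = 0.
Proof. by apply/matrixP => -[[|[|[|//]]] hi] j; rewrite !mxE. Qed.
Lemma int_pt_neq0 p : p <> o0 -> int_pt p != 0.
Proof. by move=> h; apply/eqP; rewrite -int_pt0 => /(can_inj int_ptK). Qed.

Lemma real_ptD p q : real_pt (padd p q) = real_pt p + real_pt q.
Proof. by rewrite /real_pt int_ptD of_latticeD. Qed.
Lemma real_ptZ k p : real_pt (pscale k p) = real_Z k *: real_pt p.
Proof.
apply/matrixP => i j; rewrite !mxE -intrM; case: p => [[a b] c].
by case: i => [[|[|[|//]]] hi] /=; rewrite rmorphM.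
Qed.
Lemma real_pt0 : real_pt o0 = 0.
Proof. by rewrite /real_pt int_pt0 of_lattice0. Qed.
Lemma real_pt_inj : injective real_pt.
Proof. by move=> p q /of_lattice_inj /(can_inj int_ptK). Qed.

Lemma real_ZD j k : real_Z (Z.add j k) = real_Z j + real_Z k.
Proof. by rewrite /real_Z raddfD intrD. Qed.
Lemma real_Z_gt0 k : Z.lt Z0 k -> 0 < real_Z k.
Proof.
case: k => // k' _; rewrite /real_Z ltr0z /=.
by have := Pos2Nat.is_pos k'; case: (Pos.to_nat k') => // /PeanoNat.Nat.nlt_0_r.
Qed.

Lemma wsum_ge0 A l : wts A l -> Z.le Z0 (wsum l).
Proof. by elim=> [|wp l' [h _] _ IH] //=; lia. Qed.
Lemma lcomb_wsum0 A l : wts A l -> wsum l = Z0 -> lcomb l = o0.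
Proof.
elim=> [|[w a] l' [/= h _] hl IH] //= e.
have := wsum_ge0 hl => hs; rewrite IH; last lia.
have -> : w = Z0 by lia.
by case: a => [[x y] z].
Qed.

Lemma convex_lcomb P A l : convex_set P -> (forall a, In a A -> P (real_pt a)) ->
  wts A l -> Z.lt Z0 (wsum l) -> P ((real_Z (wsum l))^-1 *: real_pt (lcomb l)).
Proof.
move=> /convex_setP cP hA; elim=> [|[w a] l' [/= hw ha] hl IH] //= hs.
have hs' := wsum_ge0 hl.
have [w0|w0] : w = Z0 \/ Z.lt Z0 w by lia.
  have -> : padd (pscale w a) (lcomb l') = lcomb l'.
    by rewrite w0; case: a {ha} (lcomb l') => [[x y] z] [[x' y'] z'].
  by rewrite w0; apply: IH; lia.
have [s0|s0] : wsum l' = Z0 \/ Z.lt Z0 (wsum l') by lia.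
  rewrite (lcomb_wsum0 hl s0) padd_o0 s0 Z.add_0_r real_ptZ scalerA mulVf ?scale1r; first exact: hA.
  by rewrite gt_eqF // real_Z_gt0.
have w0' := real_Z_gt0 w0; have s0' := real_Z_gt0 s0.
rewrite real_ptD real_ptZ real_ZD.
move: (real_Z w) (real_Z (wsum l')) (real_Z_gt0 w0) (real_Z_gt0 s0) (IH s0) => r s r0 s1 {}IH.
have d0 : 0 < r + s by rewrite addr_gt0.
have dn0 : r + s != 0 by rewrite gt_eqF.
have := cP _ _ ((r + s)^-1 * r) (hA _ ha) IH.
have -> : 1 - (r + s)^-1 * r = (r + s)^-1 * s.
  by rewrite -{1}(mulVf dn0) -mulrBr addrAC subrr add0r.
rewrite scalerDr !scalerA mulfK ?gt_eqF //; apply.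
  by rewrite mulr_ge0 // ?invr_ge0 ltW.
by rewrite mulrC ler_pdivrMr // mul1r lerDl ltW.
Qed.

Lemma real_pt_lcomb k z l : Z.lt Z0 k -> pscale k z = lcomb l ->
  (real_Z k)^-1 *: real_pt (lcomb l) = real_pt z.
Proof.
move=> k0 <-; rewrite real_ptZ scalerA mulVf ?scale1r //.
by rewrite gt_eqF // real_Z_gt0.
Qed.

Lemma inconv_real P A z : convex_set P -> (forall a, In a A -> P (real_pt a)) ->
  inconv A z -> P (real_pt z).
Proof.
move=> cP hA [l [hl hs E]]; rewrite -(real_pt_lcomb hs E); exact: convex_lcomb cP hA hl hs.
Qed.

Lemma insum_real P Q A B z : convex_set P -> convex_set Q ->
  (forall a, In a A -> P (real_pt a)) -> (forall b, In b B -> Q (real_pt b)) ->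
  insum A B z -> minkowski_add P Q (real_pt z).
Proof.
move=> cP cQ hA hB [l [m [hl hm hs e E]]].
exists ((real_Z (wsum l))^-1 *: real_pt (lcomb l)); first exact: convex_lcomb cP hA hl hs.
exists ((real_Z (wsum l))^-1 *: real_pt (lcomb m)).
  by rewrite -e; apply: (convex_lcomb cQ hB hm); rewrite e.
rewrite -scalerDr -real_ptD -E real_ptZ scalerA mulVf ?scale1r //.
by rewrite gt_eqF // real_Z_gt0.
Qed.

Lemma lattice_points_list P n : lattice_points P #= `I_n ->
  exists A : list pt, [/\ NoDup A, length A = n & forall p, In p A <-> P (real_pt p)].
Proof.
move=> /card_set_bijP[f [ff fi fs]].
have /choice[h hh] : forall i, exists p, (i < n)%N -> P (real_pt p) /\ f (real_pt p) = i.
  (* Indices from n on get the arbitrary value [o0]. *)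
  move=> i; case: (ltnP i n) => hi; last by exists o0.
  have [x [Px [z _ ez]] <-] := fs i hi; exists (pt_int z) => _.
  by rewrite /real_pt pt_intK ez.
have lat p : P (real_pt p) -> lattice_points P (real_pt p).
  by move=> hp; split=> //; exists (int_pt p).
have lt i : In i (List.seq 0 n) -> (i < n)%N by move=> /in_seq[_ /ssrnat.ltP].
exists (List.map h (List.seq 0 n)); split.
- apply: NoDup_map_in => [|i j /lt hi /lt hj e]; first exact: seq_NoDup.
  by rewrite -(hh i hi).2 -(hh j hj).2 e.
- by rewrite List.length_map length_seq.
move=> p; split=> [/in_map_iff[i [<- /lt /hh[]]] //|hp].
have hi : (f (real_pt p) < n)%N := ff _ (lat p hp).
apply/in_map_iff; exists (f (real_pt p)); split; last first.
  by apply/in_seq; split; [exact/ssrnat.leP|exact/ssrnat.ltP].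
have [h1 h2] := hh _ hi; apply: real_pt_inj.
by apply: fi; rewrite ?in_setE //; exact: lat.
Qed.

(** A vertex is defined by combinations of two points, so each weighted point a is set against the
    barycentre of all the others; if these have total weight 0, then z = a at once. *)
Lemma in_convex_position_real P A : convex_set P -> empty_polytope P ->
  (forall p, In p A <-> P (real_pt p)) -> in_convex_position A.
Proof.
move=> cP eP hA l z hl hs E; have hP a : In a A -> P (real_pt a) by move/hA.
have Pz : P (real_pt z) by apply: (inconv_real cP hP); exists l.
have [_ vz] : vertex P (real_pt z) by apply: eP; split=> //; exists (int_pt z).
apply/List.Forall_forall; case=> w a hin /= w0.
have [l1 [l2 el]] := List.in_split _ _ hin.
have : wts A l by []. rewrite el => /Forall_app[hl1 hl2'].
have [[/= _ ha] hl2] := proj1 (Forall_cons_iff _ _ _) hl2'.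
have hr : wts A (List.app l1 l2) by apply: wts_app.
have es : wsum l = Z.add w (wsum (List.app l1 l2)).
  by rewrite el !wsum_app /=; ring.
have ec : lcomb l = padd (pscale w a) (lcomb (List.app l1 l2)).
  rewrite el !lcomb_app /=; move: (lcomb l1) (lcomb l2) (pscale w a); clear => x y t.
  by pt_ring.
have hrs := wsum_ge0 hr.
have [s0|s0] : wsum (List.app l1 l2) = Z0 \/ Z.lt Z0 (wsum (List.app l1 l2)) by lia.
  apply: (pscaleI (a := w)); first lia.
  move: E; rewrite ec es s0 (lcomb_wsum0 hr s0) padd_o0 Z.add_0_r; exact: esym.
have hy := convex_lcomb cP hP hr s0.
have r0 := real_Z_gt0 w0; have t0 := real_Z_gt0 s0.
have d0 : 0 < real_Z w + real_Z (wsum (List.app l1 l2)) by rewrite addr_gt0.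
have dn0 : real_Z w + real_Z (wsum (List.app l1 l2)) != 0 by rewrite gt_eqF.
have [] // := vz _ _ (real_Z w / (real_Z w + real_Z (wsum (List.app l1 l2))))
  (hP a ha) hy; last first.
- by move=> /real_pt_inj.
- rewrite -(real_pt_lcomb hs E) ec es real_ptD real_ptZ real_ZD.
  move: (real_Z w) (real_Z (wsum (List.app l1 l2))) r0 t0 d0 dn0 => r s r0 s1 d0 dn0.
  have -> : 1 - r / (r + s) = s / (r + s).
    by rewrite -{1}(mulfV dn0) -mulrBl addrAC subrr add0r.
  by rewrite scalerDr !scalerA mulrAC mulfV ?gt_eqF // mul1r mulrC.
- by rewrite divr_gt0 //= ltr_pdivrMr // mul1r ltrDl.
Qed.

Lemma closed_real Q B : convex_set Q -> (forall p, In p B <-> Q (real_pt p)) -> closed B.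
Proof.
by move=> cQ hB z hz; apply/hB; apply: inconv_real hz => // b /hB.
Qed.

Lemma no_progression_real Q B : convex_set Q -> (forall p, In p B <-> Q (real_pt p)) ->
  ~ contains_minkowski_sum Q 2 -> no_progression B.
Proof.
move=> cQ hB h z u hu /hB h0 /hB h1 /hB h2; apply: h.
have S x y : Q (real_pt x) -> x = y -> Q (real_pt y) by move=> hx <-.
apply: (@contains_two_segments _ _ Q (int_pt z) (int_pt u) (int_pt u)) => //;
  try exact: int_pt_neq0.
move=> a b; rewrite add0r -int_ptD -int_pt0 => -[->|->] [->|->]; rewrite -int_ptD -/(real_pt _).
- by apply: S h0 _; clear; pt_ring.
- by apply: S h1 _; clear; pt_ring.
- by apply: S h1 _; clear; pt_ring.
- by apply: S h2 _; clear; pt_ring.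
Qed.

Lemma three_sum_real P Q A B : convex_set P -> convex_set Q ->
  (forall a, In a A -> P (real_pt a)) -> (forall b, In b B -> Q (real_pt b)) ->
  three_sum A B -> contains_minkowski_sum (minkowski_add P Q) 3.
Proof.
move=> cP cQ hA hB [z [u [v [w [[u0 v0 w0] [[k1 k2 k3 k4] [k5 k6 k7 k8]]]]]]].
have S x y : insum A B x -> x = y -> minkowski_add P Q (real_pt y).
  by move=> hx <-; apply: insum_real hx.
apply: (@contains_three_segments _ _ _ (int_pt z) (int_pt u) (int_pt v) (int_pt w));
  try exact: int_pt_neq0; first exact: convex_minkowski_add.
move=> a b c; rewrite !add0r -int_ptD -int_pt0.
move=> [->|->] [->|->] [->|->]; rewrite -!int_ptD -/(real_pt _).
- by apply: S k1 _; clear; pt_ring.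
- by apply: S k4 _; clear; pt_ring.
- by apply: S k3 _; clear; pt_ring.
- by apply: S k7 _; clear; pt_ring.
- by apply: S k2 _; clear; pt_ring.
- by apply: S k6 _; clear; pt_ring.
- by apply: S k5 _; clear; pt_ring.
- by apply: S k8 _; clear; pt_ring.
Qed.

Lemma conv_hull_lattice_points P A : lattice_polytope P ->
  (forall p, In p A <-> P (real_pt p)) -> P = conv_hull [set real_pt p | p in [set p | In p A]].
Proof.
move=> hP hA; have cP := lattice_polytope_convex hP.
apply/seteqP; split; last by apply: conv_hull_min => // _ [p /hA hp <-].
move: hP cP hA => [S [_ _ ->]] cP hA; apply: conv_hull_min; first exact: convex_conv_hull.
move=> _ [s hs <-]; apply: sub_conv_hull; exists (pt_int s); last by rewrite /real_pt pt_intK.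
by apply/hA; rewrite /real_pt pt_intK; apply: sub_conv_hull; exists s.
Qed.
End LatticePoints.

(** * From the integral classification to equivalence of pairs *)

Section Equivalence.
Variable R : realType.
Implicit Types (P : set 'cV[R]_3) (p q : pt).

Definition pt_matrix (r1 r2 r3 : pt) : 'M[int]_3 :=
  \matrix_(i, j) int_pt (nth o0 [:: r1; r2; r3] i) j 0.
Definition pt_apply (r1 r2 r3 : pt) (p : pt) : pt := (dot r1 p, dot r2 p, dot r3 p).

Lemma pt_apply_sub r1 r2 r3 p q :
  pt_apply r1 r2 r3 (psub p q) = psub (pt_apply r1 r2 r3 p) (pt_apply r1 r2 r3 q).
Proof. by rewrite /pt_apply; pt_ring. Qed.
Lemma pt_apply_add r1 r2 r3 p q :
  pt_apply r1 r2 r3 (padd p q) = padd (pt_apply r1 r2 r3 p) (pt_apply r1 r2 r3 q).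
Proof. by rewrite /pt_apply; pt_ring. Qed.

Lemma pt_matrixE r1 r2 r3 p :
  pt_matrix r1 r2 r3 *m int_pt p = int_pt (pt_apply r1 r2 r3 p).
Proof.
have row (r : pt) : \sum_j int_pt r j 0 * int_pt p j 0 = int_of_Z (dot r p).
  have ZD j k : int_of_Z (Z.add j k) = int_of_Z j + int_of_Z k by exact: raddfD.
  have ZM j k : int_of_Z (Z.mul j k) = int_of_Z j * int_of_Z k by exact: rmorphM.
  rewrite !big_ord_recl big_ord0 !mxE; case: r (p) => [[a b] c] [[x y] z].
  by rewrite /dot !(ZD, ZM) addr0 addrA.
apply/matrixP => i j; rewrite !ord1 !mxE -[RHS]/(int_of_Z _).
transitivity (\sum_k int_pt (nth o0 [:: r1; r2; r3] i) k 0 * int_pt p k 0).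
  by apply: eq_bigr => k _; rewrite mxE.
by rewrite row; case: i => [[|[|[|//]]] hi].
Qed.

(** The vectors b1, b2, b3 are the columns of the inverse. *)
Lemma pt_matrix_unit r1 r2 r3 b1 b2 b3 : pt_apply r1 r2 r3 b1 = e1 ->
  pt_apply r1 r2 r3 b2 = e2 -> pt_apply r1 r2 r3 b3 = e3 -> pt_matrix r1 r2 r3 \in unitmx.
Proof.
move=> h1 h2 h3; suff /mulmx1_unit[] : pt_matrix r1 r2 r3 *m (pt_matrix b1 b2 b3)^T = 1%:M by [].
apply/matrixP => i j.
have -> : (pt_matrix r1 r2 r3 *m (pt_matrix b1 b2 b3)^T) i j =
    (pt_matrix r1 r2 r3 *m int_pt (nth o0 [:: b1; b2; b3] j)) i 0.
  by rewrite !mxE; apply: eq_bigr => k _; rewrite !mxE.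
rewrite pt_matrixE.
by case: j => [[|[|[|//]]] hj] /=; rewrite ?h1 ?h2 ?h3 mxE;
  case: i => [[|[|[|//]]] hi] /=; rewrite mxE.
Qed.

Definition hull (l : list pt) : set 'cV[R]_3 :=
  conv_hull [set real_pt R p | p in [set p | In p l]].

Lemma hull_image U b l (phi : pt -> pt) :
  (forall p, map_mx intr U *m real_pt R p + b = real_pt R (phi p)) ->
  [set map_mx intr U *m x + b | x in hull l] = hull (List.map phi l).
Proof.
move=> h; rewrite conv_hull_affine; congr conv_hull; apply/seteqP; split.
  by move=> _ [_ [p hp <-] <-]; exists (phi p); [exact: in_map|rewrite h].
move=> _ [q /in_map_iff[p [<- hp]] <-]; exists (real_pt R p); last exact: h.
by exists p.
Qed.

Lemma hull_ext (l m : list pt) : (forall p, In p l <-> In p m) -> hull l = hull m.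
Proof.
by move=> h; congr conv_hull; apply/seteqP; split=> _ [p /h hp <-]; exists p.
Qed.

Lemma real_e1 : real_pt R e1 = delta_mx (0 : 'I_3) 0.
Proof. by apply/matrixP => -[[|[|[|//]]] hi] j; rewrite !mxE !ord1. Qed.
Lemma real_e2 : real_pt R e2 = delta_mx (1 : 'I_3) 0.
Proof. by apply/matrixP => -[[|[|[|//]]] hi] j; rewrite !mxE !ord1. Qed.
Lemma real_e3 : real_pt R e3 = delta_mx (2%:R : 'I_3) 0.
Proof. by apply/matrixP => -[[|[|[|//]]] hi] j; rewrite !mxE !ord1. Qed.

Lemma polytopeE_hull : polytopeE R = hull [:: o0; e1; e2; e3; padd e1 (padd e2 e3)].
Proof.
rewrite /polytopeE -real_e1 -real_e2 -real_e3 -real_pt0 -addrA -!real_ptD.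
congr conv_hull; apply/seteqP; split.
  move=> x [[[[|]|]|]|] -> /=; by [exists o0 => //=; tauto|exists e1 => //=; tauto|
    exists e2 => //=; tauto|exists e3 => //=; tauto|
    exists (padd e1 (padd e2 e3)) => //=; tauto].
by move=> _ [p [<-|[<-|[<-|[<-|[<-|//]]]]] <-] /=; tauto.
Qed.

Lemma polytopeS2_hull : polytopeS2 R = hull [:: e1; e2; e3; padd e1 (padd e2 e3)].
Proof.
rewrite /polytopeS2 -real_e1 -real_e2 -real_e3 -addrA -!real_ptD.
congr conv_hull; apply/seteqP; split.
  by move=> x [[[|]|]|] -> /=; eexists; (try reflexivity) => /=; tauto.
by move=> _ [p [<-|[<-|[<-|[<-|//]]]] <-] /=; tauto.
Qed.

Lemma ES2_equivalent A B : ES2 A B ->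
  equivalent_pairs (hull A) (hull B) (polytopeE R) (polytopeS2 R).
Proof.
move=> [a0 [a1 [a2 [a3 [a4 [c [h1 h2 h3 h4]]]]]]].
set b1 := psub a1 a0 in h2; set b2 := psub a2 a0 in h2; set b3 := psub a3 a0 in h2.
have [s hs] : exists s, Z.mul s (det b1 b2 b3) = Zpos 1.
  by exists (det b1 b2 b3); lia.
(* The rows are those of the adjugate of the matrix with columns b1, b2, b3, divided by its
   determinant; s is the determinant, which is its own inverse, being 1 or -1. *)
pose r1 := pscale s (cross b2 b3); pose r2 := pscale s (cross b3 b1).
pose r3 := pscale s (cross b1 b2); pose T := pt_apply r1 r2 r3.
have T1 : T b1 = e1.
  rewrite /T /pt_apply /r1 /r2 /r3; clearbody b1 b2 b3; clear -hs.
  by apply: pt_ext; rewrite -?hs; pt_ring.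
have T2 : T b2 = e2.
  rewrite /T /pt_apply /r1 /r2 /r3; clearbody b1 b2 b3; clear -hs.
  by apply: pt_ext; rewrite -?hs; pt_ring.
have T3 : T b3 = e3.
  rewrite /T /pt_apply /r1 /r2 /r3; clearbody b1 b2 b3; clear -hs.
  by apply: pt_ext; rewrite -?hs; pt_ring.
have TB x y : T (psub x y) = psub (T x) (T y) by exact: pt_apply_sub.
have TD x y : T (padd x y) = padd (T x) (T y) by exact: pt_apply_add.
have T4 : T (psub a4 a0) = padd e1 (padd e2 e3).
  have -> : psub a4 a0 = padd b1 (padd b2 b3).
    have -> : a4 = psub (padd a4 (padd a0 a0)) (padd a0 a0) by clear => *; pt_ring.
    by rewrite -h1 /b1 /b2 /b3; clear => *; pt_ring.
  by rewrite !TD T1 T2 T3.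
have T0 : T (psub a0 a0) = o0 by rewrite TB; move: (T a0); clear => *; pt_ring.
pose d := psub o0 (T a0).
have UE p : map_mx intr (pt_matrix r1 r2 r3) *m real_pt R p = real_pt R (T p).
  by rewrite /real_pt /of_lattice -map_mxM pt_matrixE.
exists (fun x => map_mx intr (pt_matrix r1 r2 r3) *m x + of_lattice R (int_pt d)).
exists (int_pt o0), (int_pt (psub o0 (T c))); split.
- by exists (pt_matrix r1 r2 r3), (int_pt d); split=> //; exact: pt_matrix_unit T1 T2 T3.
- have -> : [set map_mx intr (pt_matrix r1 r2 r3) *m x + of_lattice R (int_pt d) +
      of_lattice R (int_pt o0) | x in hull A] =
    [set map_mx intr (pt_matrix r1 r2 r3) *m x + real_pt R d | x in hull A].
    by apply: eq_imagel => x _; rewrite -/(real_pt R o0) real_pt0 addr0.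
  rewrite (hull_ext h3) (@hull_image _ _ _ (fun p => T (psub p a0))).
    by rewrite /= T0 T1 T2 T3 T4 polytopeE_hull.
  move=> p; rewrite UE -real_ptD TB (_ : padd (T p) d = psub (T p) (T a0)); first by [].
  by rewrite /d; move: (T p) (T a0); clear => *; pt_ring.
- have -> : [set map_mx intr (pt_matrix r1 r2 r3) *m x + of_lattice R (int_pt d) +
      of_lattice R (int_pt (psub o0 (T c))) | x in hull B] =
    [set map_mx intr (pt_matrix r1 r2 r3) *m x + real_pt R (psub d (T c)) | x in hull B].
    apply: eq_imagel => x _; rewrite -addrA -of_latticeD -int_ptD -/(real_pt R _).
    rewrite (_ : padd d _ = psub d (T c)); first by [].
    by move: d (T c); clear => *; pt_ring.
  rewrite (hull_ext h4) (@hull_image _ _ _ (fun p => T (psub (psub p c) a0))).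
    have e x : psub (padd c x) c = x by clear => *; pt_ring.
    by rewrite /= !e T1 T2 T3 T4 polytopeS2_hull.
  move=> p; rewrite UE -real_ptD !TB.
  rewrite (_ : padd (T p) _ = psub (psub (T p) (T c)) (T a0)); first by [].
  by rewrite /d; move: (T p) (T a0) (T c); clear => *; pt_ring.
Qed.
End Equivalence.

Theorem theorem3p6 (R : realType) (P Q : set 'cV[R]_3)
  (hP : lattice_polytope P) (emptyP : empty_polytope P)
  (cardP : lattice_points P #= `I_5) (LP : has_minkowski_length P 1%N)
  (hQ : lattice_polytope Q)
  (cardQ : lattice_points Q #= `I_4) (LQ : has_minkowski_length Q 1%N)
  (LPQ : has_minkowski_length (minkowski_add P Q) 2%N) :
  equivalent_pairs P Q (polytopeE R) (polytopeS2 R).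
Proof.
have [A [nA lA hA]] := lattice_points_list cardP.
have [B [nB lB hB]] := lattice_points_list cardQ.
have cP := lattice_polytope_convex hP; have cQ := lattice_polytope_convex hQ.
rewrite (conv_hull_lattice_points hP hA) (conv_hull_lattice_points hQ hB).
apply: ES2_equivalent; apply: integer_classification => //.
- exact: in_convex_position_real hA.
- split=> //; first exact: closed_real hB.
  by apply: (no_progression_real cQ hB) => /LQ.2.
- move=> h; have /LPQ.2 // : contains_minkowski_sum (minkowski_add P Q) 3.
  by apply: (three_sum_real cP cQ _ _ h) => p; [move/hA|move/hB].
Qed.
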